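(* Let $U\in AC_g([a,b];\mathbb R^d)$. Then $U\in BV([a,b];\mathbb R^d)$ and its canonical derivative measure $DU$ on $[a,b)$, whose restriction to $(a,b)$ is the classical distributional derivative of $U$, is $$DU=(D_gU)\,\mu_g .$$ In particular, if $$\mu_g=\rho_g\,dt+\mu_g^{\mathrm{sc}}+\sum_{t\in J_g}\Delta g(t)\,\delta_t$$ is the Lebesgue decomposition of $\mu_g$ (absolutely continuous, singular continuous and atomic parts), then $$DU=(D_gU)\rho_g\,dt+(D_gU)\,\mu_g^{\mathrm{sc}}+\sum_{t\in J_g}\Delta g(t)\,D_gU(t)\,\delta_t .$$
   Context: Let $a<b$ be real, $d\in\mathbb N$, and let $g:[a,b]\to\mathbb R$ be nondecreasing and left-continuous. $\mu_g$ is the finite Lebesgue--Stieltjes measure on $[a,b)$ with $\mu_g([s,t))=g(t)-g(s)$ for $a\le s\le t\le b$. Standing assumption: $M_g:=\mu_g([a,b))=g(b)-g(a)>0$. $L_g^1([a,b))$ is the $L^1$ space for the completion of $\mu_g$; vector-valued spaces and integrals are componentwise. $J_g:=\{t\in[a,b):\Delta g(t):=g(t^+)-g(t)>0\}$ is the set of jump points, so $\mu_g(\{t\})=\Delta g(t)$ for $t\in J_g$. $AC_g([a,b];\mathbb R^d)$ is the set of functions $u:[a,b]\to\mathbb R^d$ such that, in each component, for every $\varepsilon>0$ there is $\delta>0$ such that, for every finite family of pairwise disjoint intervals $[a_j,b_j)\subset[a,b)$, $\sum_j(g(b_j)-g(a_j))<\delta$ implies $\sum_j|u(b_j)-u(a_j)|<\varepsilon$;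 equivalently (known), $u(t)=u(a)+\int_{[a,t)}v\,d\mu_g$ for all $t\in[a,b]$ with some $v\in L_g^1$, which is $\mu_g$-a.e. unique and denoted $D_gu$. Such functions are left-continuous. For a left-continuous $U\in BV([a,b];\mathbb R^d)$, $DU$ denotes the canonical finite vector Borel measure on $[a,b)$ characterized by $DU([s,t))=U(t)-U(s)$ for $a\le s\le t\le b$ (so a mass $U(a^+)-U(a)$ at $a$ is included). *)

(* Defs.v *)
From HB Require Import structures.
From mathcomp Require Import all_boot all_order all_algebra.
From mathcomp Require Import all_classical all_reals all_analysis.
From mathcomp Require Import measurable_realfun.

Set Implicit Arguments.
Unset Strict Implicit.
Unset Printing Implicit Defensive.
Import Order.TTheory GRing.Theory Num.Theory.
Import numFieldNormedType.Exports.

Local Open Scope classical_set_scope.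
Local Open Scope ring_scope.

(* Functions on [a, b] are represented by total functions on R; no notion
   below depends on their values outside [a, b]. *)
Record derivator (R : realType) (a b : R) := Derivator {
  derivator_fun :> R -> R ;
  derivator_nondecreasing : {in `[a, b] &, {homo derivator_fun : x y / x <= y}} ;
  derivator_left_continuous : forall t, a < t -> t <= b ->
    derivator_fun x @[x --> t^'-] --> derivator_fun t }.
Arguments derivator_left_continuous {R a b} _ {t}.

(* The library builds Lebesgue-Stieltjes measures from right-continuous
   functions, with mass f y - f x on ]x, y]. For a left-continuous g, we apply it
   to x |-> - g (- x), with g extended by constants outside [a, b], and
   transport the result by x |-> - x. *)
Section stieltjes.
Context {R : realType} (a b : R).

Definition clamp (x : R) : R := Num.max a (Num.min b x).

Definition reflected (g : derivator a b) (x : R) : R := - g (clamp (- x)).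

Let clamp_itv (x : R) : a <= b -> clamp x \in `[a, b].
Proof.
move=> ab; rewrite in_itv/= /clamp le_max lexx/= ge_max ab/=.
by rewrite ge_min lexx.
Qed.

Let le_clamp : {homo clamp : x y / x <= y}.
Proof.
move=> x y xy; rewrite /clamp ge_max le_max lexx/= le_max; apply/orP; right.
by rewrite le_min !ge_min lexx/= xy orbT.
Qed.

Let clamp_cst x : b < a -> clamp x = a.
Proof.
by move=> ba; apply/max_idPl; rewrite ge_min (ltW ba).
Qed.

Let reflected_nd g : {homo reflected g : x y / x <= y}.
Proof.
move=> x y xy; rewrite /reflected lerN2.
have [ab|ba] := leP a b; last by rewrite !clamp_cst.
apply: derivator_nondecreasing; [exact: clamp_itv|exact: clamp_itv|].
by apply: le_clamp; rewrite lerN2.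
Qed.

Let reflected_rc g : right_continuous (reflected g).
Proof.
move=> x; have [ab|ba] := leP a b; last first.
  rewrite /reflected; under eq_fun do rewrite clamp_cst//.
  by rewrite clamp_cst//; exact: cvg_cst.
suff H : (g \o clamp) y @[y --> (- x)^'-] --> (g \o clamp) (- x).
  apply: (@cvgN _ R^o); move: H => /cvg_at_leftNP; rewrite opprK; exact.
set t := - x.
have [ta|at_] := leP t a.
  have E y : y <= a -> clamp y = a.
    by move=> ya; apply/max_idPl; rewrite ge_min ya orbT.
  rewrite /= E//; apply: cvg_near_cst; near=> y => /=.
  by rewrite E// (le_trans _ ta)//; near: y; exact: nbhs_left_le.
have [tb|bt] := leP t b.
  have E y : a <= y -> y <= b -> clamp y = y.
    by move=> ay yb; rewrite /clamp (min_idPr yb) (max_idPr ay).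
  rewrite /= E ?(ltW at_)//.
  apply: cvg_trans; last exact: (derivator_left_continuous g at_ tb).
  apply: near_eq_cvg; near=> y => /=; rewrite E//.
  - by near: y; apply: nbhs_left_ge.
  - by rewrite (le_trans _ tb)//; near: y; exact: nbhs_left_le.
have E y : b <= y -> clamp y = b.
  by move=> yb; rewrite /clamp (min_idPl yb) (max_idPr ab).
rewrite /= E ?(ltW bt)//; apply: cvg_near_cst; near=> y => /=.
by rewrite E//; near: y; apply: nbhs_left_ge.
Unshelve. all: by end_near. Qed.

HB.instance Definition _ g :=
  isCumulative.Build R _ R (reflected g) (@reflected_nd g) (@reflected_rc g).

Lemma lebesgue_stieltjes_measure_oc (f : cumulative R R) (x y : R) : x <= y ->
  lebesgue_stieltjes_measure f `]x, y] = (f y - f x)%:E.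
Proof.
move=> xy; rewrite /lebesgue_stieltjes_measure /measure_extension.
by rewrite measurable_mu_extE/=; [rewrite wlength_itv_bnd|exact: is_ocitv].
Qed.

Definition mirror_measure (g : derivator a b) :
    set (measurableTypeR R) -> \bar R :=
  pushforward (lebesgue_stieltjes_measure (reflected g))
    (-%R : measurableTypeR R -> measurableTypeR R).

Section mirror_measure_is_measure.
Variable g : derivator a b.

Let opp_measurable (A : set (measurableTypeR R)) : measurable A ->
  measurable (-%R @^-1` A : set (measurableTypeR R)).
Proof.
by move=> mA; rewrite -[X in measurable X]setTI; exact: oppr_measurable.
Qed.

Let mirror0 : mirror_measure g set0 = 0%E.
Proof. by rewrite /mirror_measure /pushforward preimage_set0 measure0. Qed.

Let mirror_ge0 A : (0 <= mirror_measure g A)%E.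
Proof. exact: measure_ge0. Qed.

Let mirror_sigma_additive : semi_sigma_additive (mirror_measure g).
Proof.
move=> F mF tF mUF; rewrite /mirror_measure /pushforward preimage_bigcup.
apply: measure_semi_sigma_additive.
- by move=> n; exact: opp_measurable.
- apply/trivIsetP => /= i j _ _ ij; rewrite -preimage_setI.
  by move/trivIsetP : tF => /(_ _ _ _ _ ij) ->//; rewrite preimage_set0.
- by rewrite -preimage_bigcup; exact: opp_measurable.
Qed.

HB.instance Definition _ := isMeasure.Build _ _ _ (mirror_measure g)
  mirror0 mirror_ge0 mirror_sigma_additive.
End mirror_measure_is_measure.

Lemma mirror_measure_co g (s t : R) : a <= s -> s <= t -> t <= b ->
  mirror_measure g `[s, t[ = (g t - g s)%:E.
Proof.
move=> as_ st tb.
have E y : a <= y -> y <= b -> clamp y = y.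
  by move=> ay yb; rewrite /clamp (min_idPr yb) (max_idPr ay).
rewrite /mirror_measure/= /pushforward.
have -> : -%R @^-1` `[s, t[ = `]- t, - s]%classic :> set R.
  apply/seteqP; split=> x /=; rewrite !in_itv/=.
    by rewrite lerNr ltrNl andbC.
  by rewrite lerNr ltrNl andbC.
rewrite lebesgue_stieltjes_measure_oc ?lerN2//=.
rewrite /reflected !opprK !E//; first by rewrite addrC.
- exact: le_trans as_ st.
- exact: le_trans st tb.
Qed.

Let mirror_measure_lty g : (mirror_measure g `[a, b[ < +oo)%E.
Proof.
have [ab|ba] := leP a b; first by rewrite mirror_measure_co// ltry.
by rewrite set_itv_ge ?bnd_simp -?leNgt ?(ltW ba)// measure0.
Qed.

Definition stieltjes_measure (g : derivator a b) :
    set (measurableTypeR R) -> \bar R :=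
  @mfrestr _ (measurableTypeR R) R _ (mirror_measure g) (measurable_itv `[a, b[)
    (mirror_measure_lty g).

HB.instance Definition _ g := FiniteMeasure.on (stieltjes_measure g).

Lemma stieltjes_measure_co g (s t : R) : a <= s -> s <= t -> t <= b ->
  stieltjes_measure g `[s, t[ = (g t - g s)%:E.
Proof.
move=> as_ st tb; rewrite /stieltjes_measure/= /mfrestr /mrestr.
rewrite setIidl ?mirror_measure_co// => x/=; rewrite !in_itv/= => /andP[sx xt].
by rewrite (le_trans as_ sx) (lt_le_trans xt tb).
Qed.

Lemma stieltjes_measure_out g (A : set R) : A `&` `[a, b[ = set0 ->
  stieltjes_measure g A = 0%E.
Proof. by move=> A0; rewrite /stieltjes_measure/= /mfrestr /mrestr A0 measure0. Qed.

End stieltjes.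

(* The completion of a Borel measure: the outer measure it induces, on the
   sigma-algebra of Caratheodory-measurable sets. *)
Section completion.
Context {R : realType} (mu : {measure set (measurableTypeR R) -> \bar R}).

Definition completion := @completed_measure_extension _ (measurableTypeR R) R mu.

HB.instance Definition _ := Measure.on completion.

Lemma completion_is_complete : measure_is_complete completion.
Proof. exact: measure_is_complete_caratheodory. Qed.

Lemma completionE (A : set (measurableTypeR R)) : measurable A ->
  completion A = mu A.
Proof. by move=> mA; exact: measurable_mu_extE. Qed.
End completion.
Arguments completion {R} mu.

Section gAC.
Context {R : realType} {a b : R} (g : derivator a b) {d : nat}.
Implicit Types U v : R -> 'rV[R]_d.

Definition ACg U : Prop := forall i : 'I_d, forall e : R, 0 < e ->
  exists2 dlt : R, 0 < dlt &
    forall (n : nat) (s t : 'I_n -> R),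
      (forall j, [/\ a <= s j, s j < t j & t j <= b]) ->
      trivIset [set: 'I_n] (fun j => `[s j, t j[%classic) ->
      \sum_(j < n) (g (t j) - g (s j)) < dlt ->
      \sum_(j < n) `|U (t j) ord0 i - U (s j) ord0 i| < e.

Definition in_L1g v : Prop := forall i : 'I_d,
  (completion (stieltjes_measure g)).-integrable `[a, b[
    (fun x => (v x ord0 i)%:E).

(* v is a representative of the class D_g U. *)
Definition is_gderivative U v : Prop :=
  in_L1g v /\
  forall (i : 'I_d) (t : R), a <= t -> t <= b ->
    ((U t ord0 i)%:E = (U a ord0 i)%:E +
      \int[completion (stieltjes_measure g)]_(x in `[a, t[)
        (v x ord0 i)%:E)%E.

Definition jump (t : R) : R := lim (g x @[x --> t^'+]) - g t.

Definition jumps : set R := [set t | [/\ a <= t, t < b & 0 < jump t]].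
End gAC.

Definition BV {R : realType} (a b : R) {d : nat} (U : R -> 'rV[R]_d) : Prop :=
  forall i : 'I_d, bounded_variation a b (fun t => U t ord0 i).

(* The charges DU i live on R, but only their values on Borel subsets of [a, b[
   are specified; these are determined by the values on the intervals [s, t[. *)
Definition is_derivative_measure {R : realType} (a b : R) {d : nat}
    (U : R -> 'rV[R]_d)
    (DU : 'I_d -> {charge set (measurableTypeR R) -> \bar R}) : Prop :=
  forall (i : 'I_d) (s t : R), a <= s -> s <= t -> t <= b ->
    DU i `[s, t[%classic = (U t ord0 i - U s ord0 i)%:E.

Section charge_integral.
Context d (T : measurableType d) (R : realType).
Variable nu : {charge set T -> \bar R}.

Let P := projT1 (cid (Hahn_decomposition nu)).
Let N := projT1 (cid (projT2 (cid (Hahn_decomposition nu)))).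
Let nuPN : hahn_decomposition nu P N :=
  projT2 (cid (projT2 (cid (Hahn_decomposition nu)))).

(* By uniqueness of the Jordan decomposition, this does not depend on the chosen
   Hahn decomposition. *)
Definition charge_integral (D : set T) (f : T -> \bar R) : \bar R :=
  (\int[jordan_pos nuPN]_(x in D) f x - \int[jordan_neg nuPN]_(x in D) f x)%E.
End charge_integral.

Definition test_function {R : realType} (a b : R) (phi : R -> R) : Prop :=
  (forall (n : nat) (x : R), derivable (derive1n n phi) x 1) /\
  exists c e : R, [/\ a < c, e < b & forall x, x \notin `[c, e] -> phi x = 0].

Definition is_distributional_derivative {R : realType} (a b : R) {d : nat}
    (U : R -> 'rV[R]_d)
    (DU : 'I_d -> {charge set (measurableTypeR R) -> \bar R}) : Prop :=
  forall (i : 'I_d) (phi : R -> R), test_function a b phi ->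
    (\int[lebesgue_measure]_(x in `]a, b[) (U x ord0 i * derive1 phi x)%:E =
     - charge_integral (DU i) `]a, b[%classic (EFin \o phi))%E.

(* \esum only handles nonnegative terms. *)
Definition signed_esum {R : realType} {T : choiceType} (D : set T)
    (f : T -> \bar R) : \bar R :=
  (\esum_(t in D) f^\+ t - \esum_(t in D) f^\- t)%E.

Record lebesgue_decomposition {R : realType} (a b : R) (g : derivator a b)
    (rho : R -> R)
    (musc : {finite_measure set (measurableTypeR R) -> \bar R}) : Prop := {
  density_integrable :
    completed_lebesgue_measure.-integrable `[a, b[ (fun x => (rho x)%:E) ;
  density_ge0 : {ae completed_lebesgue_measure, forall x : R,
    a <= x -> x < b -> 0 <= rho x} ;
  sc_singular : exists N : set (measurableTypeR R),
    [/\ measurable N, lebesgue_measure N = 0%E & musc (`[a, b[ `\` N) = 0%E] ;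
  sc_continuous : forall t : R, a <= t -> t < b -> musc [set t] = 0%E ;
  decompositionE : forall A : set (measurableTypeR R),
    measurable A -> A `<=` `[a, b[ ->
    (stieltjes_measure g A =
      \int[completed_lebesgue_measure]_(x in A) (rho x)%:E
      + musc A
      + \esum_(t in jumps g) (jump g t)%:E * \d_t A)%E }.

(* Main.v *)
Require Import Defs.
From HB Require Import structures.
From mathcomp Require Import all_boot all_order all_algebra.
From mathcomp Require Import all_classical all_reals all_analysis.
From mathcomp Require Import measurable_realfun.
From mathcomp Require Import ring lra.
Import Order.TTheory GRing.Theory Num.Theory.
Import numFieldNormedType.Exports.
Local Open Scope classical_set_scope.
Local Open Scope ring_scope.
Set Implicit Arguments.
Unset Strict Implicit.
Unset Printing Implicit Defensive.

(* A scalar function u that is absolutely continuous with respect to g has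
   bounded variation: a small enough left neighbourhood, and a small enough
   punctured right neighbourhood, of any point carries little mass of g, hence
   little variation of u. Its total variation V is again absolutely continuous
   with respect to g, so u = V - W with V and W = V - u nondecreasing,
   left-continuous and absolutely continuous with respect to g. Covering a
   mu_g-null set by intervals of small total mass shows that the Stieltjes
   measures of V and W are dominated by mu_g; their Radon-Nikodym densities give
   D_g u. A charge is determined by its values on the intervals [s, t[, so any
   derivative measure DU is both (D_g u) mu_g and dV - dW. From the second form,
   Fubini applied to phi'(t) 1_{x < t} gives the distributional derivative. The
   Lebesgue decomposition of DU is that of mu_g integrated against a Borel
   version of D_g u, after splitting [a, b[ into the jumps, the rest of a
   Lebesgue-null set carrying the singular continuous part, and the
   remainder. *)

(** * Densities and completions *)

Section density.
Local Open Scope ereal_scope.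
Import HBNNSimple.

(* With phi the identity from a larger sigma-algebra to the Borel sets, this
   also transfers integrals between a measure and its completion. *)
Lemma ge0_integral_density d1 d2 (X : measurableType d1) (Y : measurableType d2)
    (R : realType) (phi : X -> Y) (la : {measure set X -> \bar R})
    (nu : {measure set Y -> \bar R}) (r : X -> R) (D : set Y)
    (f : Y -> \bar R) :
  measurable_fun [set: X] phi -> measurable D ->
  measurable_fun (phi @^-1` D) r -> (forall x, D (phi x) -> (0 <= r x)%R) ->
  (forall A, measurable A -> A `<=` D ->
    nu A = \int[la]_(x in phi @^-1` A) (r x)%:E) ->
  measurable_fun D f -> (forall y, D y -> 0 <= f y) ->
  \int[nu]_(y in D) f y =
  \int[la]_(x in phi @^-1` D) (f (phi x) * (r x)%:E).
Proof.
move=> mphi mD mr r0 nuE mf f0.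
have mpre A : measurable A -> measurable (phi @^-1` A).
  by move=> mA; rewrite -[X in measurable X]setTI; exact: mphi.
have mE := mpre _ mD.
have mrE : measurable_fun (phi @^-1` D) (EFin \o r) by exact/measurable_EFinP.
(* Monotone convergence along [h] on both sides reduces the claim to simple functions, then by
   additivity to indicators, where it is [nuE]. *)
pose h := nnsfun_approx mD mf.
have mh n : measurable_fun (phi @^-1` D) (fun x => (h n (phi x))%:E).
  apply/measurable_EFinP; apply: measurable_funTS.
  by apply: measurableT_comp mphi; exact: measurable_funP.
have -> : \int[nu]_(y in D) f y =
    limn (fun n => \int[nu]_(x in D) (EFin \o h n) x).
  rewrite -monotone_convergence//.
  - apply: eq_integral => y /[!inE] Dy; apply/esym/cvg_lim => //.
    exact: cvg_nnsfun_approx.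
  - by move=> n; apply/measurable_EFinP/measurable_funTS/measurable_funP.
  - by move=> n y _; rewrite lee_fin.
  - by move=> y _ m n mn; rewrite lee_fin; exact/lefP/nd_nnsfun_approx.
have -> : \int[la]_(x in phi @^-1` D) (f (phi x) * (r x)%:E) =
    limn (fun n => \int[la]_(x in phi @^-1` D) ((h n (phi x))%:E * (r x)%:E)).
  rewrite -monotone_convergence//.
  - apply: eq_integral => x /[!inE] Dx; apply/esym/cvg_lim => //.
    by apply: cvgeZr => //; exact: cvg_nnsfun_approx.
  - by move=> n; exact: emeasurable_funM.
  - by move=> n x Dx; rewrite mule_ge0 ?lee_fin ?r0.
  - move=> x Dx m n mn; rewrite lee_wpmul2r ?lee_fin ?r0//.
    exact/lefP/nd_nnsfun_approx.
congr (limn _); apply/funext => n /=.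
have mind k : measurable_fun D (fun y => (k * \1_(h n @^-1` [set k]) y)%:E).
  apply/measurable_EFinP; apply: measurable_funTS.
  by apply: measurable_funM => //; exact: measurable_indic.
have mind' k : measurable_fun (phi @^-1` D)
    (fun x => (\1_(h n @^-1` [set k]) (phi x))%:E : \bar R).
  apply/measurable_EFinP; apply: measurable_funTS.
  by apply: measurableT_comp mphi; exact: measurable_indic.
transitivity (\int[nu]_(y in D)
    \sum_(k \in range (h n)) (k * \1_(h n @^-1` [set k]) y)%:E).
  by apply: eq_integral => t tE; rewrite /= fimfunE -fsumEFin.
rewrite ge0_integral_fsum//; last by move=> k y _; exact: nnfun_muleindic_ge0.
transitivity (\int[la]_(x in phi @^-1` D) (\sum_(k \in range (h n))
    (k * \1_(h n @^-1` [set k]) (phi x))%:E * (r x)%:E)); last first.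
  apply: eq_integral => x /[!inE] Dx.
  rewrite -ge0_mule_fsuml => [|k]; last exact: nnfun_muleindic_ge0.
  by rewrite fsumEFin// -fimfunE.
rewrite ge0_integral_fsum//; last 2 first.
  - move=> k; apply: emeasurable_funM => //.
    under eq_fun do rewrite EFinM.
    exact: emeasurable_funM.
  - move=> k x Dx; apply: mule_ge0; first exact: nnfun_muleindic_ge0.
    by rewrite lee_fin r0.
apply: eq_fsbigr => k; rewrite inE => -[y0 _ <-].
set k0 := h n y0.
under eq_integral do rewrite EFinM.
rewrite integralZl_indic_nnsfun//.
under [RHS]eq_integral do rewrite EFinM -muleA.
rewrite ge0_integralZl ?lee_fin//; last 2 first.
- exact: emeasurable_funM.
- by move=> x Dx; rewrite mule_ge0 ?lee_fin ?r0.
congr (_ * _); rewrite integral_indic//.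
rewrite nuE; [|exact: measurableI|exact: subIsetr].
have -> : phi @^-1` (h n @^-1` [set k0] `&` D) =
    phi @^-1` D `&` phi @^-1` (h n @^-1` [set k0]) by exact: setIC.
rewrite integral_mkcondr; apply: eq_integral => x _.
rewrite /patch indicE /=.
have -> : (x \in phi @^-1` (h n @^-1` [set k0])) = (phi x \in h n @^-1` [set k0]).
  by apply/idP/idP; rewrite !inE.
by case: ifPn => _; rewrite ?mul1e ?mul0e.
Qed.

End density.

(** * Borel versions for the completion of a finite measure *)

Section completion_versions.
Context (R : realType) (mu : {finite_measure set (measurableTypeR R) -> \bar R}).
Local Notation muc := (completion mu).
Local Open Scope ereal_scope.

(** Borel covers of [X] with excess below [1/(n+1)] are intersected over [n]; finiteness of [mu]
    makes the infimum defining the outer measure finite, hence approachable. *)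
Lemma measurable_hull (X : set R) : exists F : set (measurableTypeR R),
  [/\ measurable F, X `<=` F & mu F = mu_ext mu X].
Proof.
have fX : mu_ext mu X \is a fin_num.
  rewrite ge0_fin_numE ?outer_measure_ge0//.
  apply: (@le_lt_trans _ _ (mu_ext mu setT)); first exact: le_outer_measure.
  by rewrite measurable_mu_extE// ltey_eq fin_num_measure.
have /choice[A AP] (n : nat) : exists A : nat -> set (measurableTypeR R),
    @measurable_cover _ (measurableTypeR R) X A /\
    \sum_(k <oo) mu (A k) < mu_ext mu X + (n.+1%:R^-1)%:E.
  have n0 : (0 < n.+1%:R^-1 :> R)%R by rewrite invr_gt0.
  by move/lb_ereal_inf_adherent : fX => /(_ _ n0)[_/= [A XA] <-] ?; exists A.
pose F := \bigcap_n \bigcup_k A n k.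
have mA n k : measurable (A n k) by have [[]] := AP n.
have mF : measurable F.
  by apply: bigcapT_measurable => n; exact: bigcupT_measurable.
have XF : X `<=` F by apply: sub_bigcap => n _; have [[]] := AP n.
exists F; split=> //; apply/eqP; rewrite eq_le; apply/andP; split; last first.
  by rewrite -(measurable_mu_extE mu mF); exact: le_outer_measure.
apply/lee_addgt0Pr => _/posnumP[e]; near \oo => n.
apply: (@le_trans _ _ (mu (\bigcup_k A n k))).
  apply: le_measure; rewrite ?inE//; first exact: bigcupT_measurable.
  exact: bigcap_inf.
apply: le_trans (_ : \sum_(k <oo) mu (A n k) <= _).
  by apply: measure_sigma_subadditive => //; exact: bigcupT_measurable.
apply/ltW/(lt_le_trans (AP n).2); rewrite leeD2l// lee_fin ltW//.
by near: n; exact: near_infty_natSinv_lt.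
Unshelve. all: by end_near. Qed.

(** Let [F] be a Borel hull of the complement of [X]. The Caratheodory condition for [X], tested on
    [F], shows that [F] meets [X] in a null set, since [mu F] is finite and equals the outer measure
    of that complement. So [B] is the complement of [F], and [Z] a hull of the null set. *)
Lemma completion_measurable_inner (X : set (caratheodory_type (mu_ext mu))) :
  measurable X -> exists B Z : set (measurableTypeR R),
  [/\ measurable B, measurable Z, mu Z = 0, B `<=` X & X `\` B `<=` Z].
Proof.
move=> mX; have [F [mF XF muF]] := measurable_hull (~` X).
have [Z [mZ XZ muZ]] := measurable_hull (X `&` F).
exists (~` F), Z; split=> //; first exact: measurableC.
- have := mX F; rewrite /= measurable_mu_extE//.
  have -> : F `&` ~` X = ~` X by apply/setIidPr.
  have fF : mu F \is a fin_num by exact: fin_num_measure.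
  rewrite [F `&` X]setIC -muF -muZ => /(congr1 (fun t => t - mu F)).
  by rewrite subee// addeK.
- by move=> x nFx; apply: contrapT => nXx; exact/nFx/XF.
- by rewrite setDE setCK.
Qed.

(** The sublevel sets of [f] at rational levels are Borel up to null sets. Off the union [ZZ] of
    these null sets they determine all sublevel sets, so [f], set to [0] outside [D] minus [ZZ], is
    Borel. *)
Lemma completion_measurable_fun_version (D : set (measurableTypeR R))
    (f : R -> R) :
  measurable_fun (D : set (caratheodory_type (mu_ext mu))) f -> measurable D ->
  exists w : measurableTypeR R -> R, exists Z : set (measurableTypeR R),
  [/\ measurable_fun [set: measurableTypeR R] w, measurable Z, mu Z = 0 &
      forall x, D x -> ~ Z x -> w x = f x].
Proof.
(* [q] enumerates the rationals by their codes; an integer that encodes none gives the level [0],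
   which is harmless since [B n] always lies in the sublevel set of level [q n]. *)
move=> mf mD; pose q (n : nat) : R := ratr (odflt 0%R (unpickle n) : rat).
have mDc : measurable (D : set (caratheodory_type (mu_ext mu))).
  exact: caratheodory_measurable_mu_ext.
have /choice[B /choice[Z BZ]] (n : nat) := completion_measurable_inner
  (mf mDc _ (measurable_itv `]-oo, q n[)).
pose ZZ := \bigcup_n Z n.
have mZZ : measurable ZZ.
  by apply: bigcupT_measurable => n; have [] := BZ n.
exists (f \_ (D `\` ZZ)), ZZ; split => //; last 2 first.
- have : mu.-negligible ZZ.
    apply: negligible_bigcup => n; have [_ mZ Z0 _ _] := BZ n.
    by apply/negligibleP.
  by move/negligibleP; exact.
- by move=> x Dx nZx; rewrite patchE mem_set.
apply/(measurable_restrictT _ _).1; first exact: measurableD.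
apply: (measurability (@RGenInftyO.G R)) => [|/= _ [_] [r] -> <-].
  exact: RGenInftyO.measurableE.
rewrite [X in measurable X](_ : _ =
    \bigcup_n (if (q n < r)%R then B n `\` ZZ else set0)).
  apply: bigcupT_measurable => n; case: ifPn => // _; apply: measurableD => //.
  by have [] := BZ n.
apply/seteqP; split=> [x [[Dx nZx]]|x [n _]].
- rewrite /= in_itv/= => fxr; have [p /andP[fp pr]] := rat_in_itvoo fxr.
  exists (pickle p) => //; rewrite /q pickleK/= -/(q _) ifT//.
  have [_ _ _ _ XB] := BZ (pickle p).
  split=> //; apply: contrapT => nBx; apply: nZx; exists (pickle p) => //.
  by apply: XB; split=> //; split=> //=; rewrite in_itv/= /q pickleK.
- case: ifPn => // qr [Bx nZx]; have [_ _ _ BX _] := BZ n.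
  have [Dx] := BX _ Bx; rewrite /= !in_itv/= => fq; split=> //.
  exact: lt_trans qr.
Qed.

(** An instance of the density formula, for the identity map from Caratheodory-measurable to Borel
    sets and density [1]. *)
Lemma ge0_integral_completion (D : set (measurableTypeR R))
    (f : measurableTypeR R -> \bar R) :
  measurable D -> measurable_fun D f -> (forall x, D x -> 0 <= f x) ->
  \int[muc]_(x in D) f x = \int[mu]_(x in D) f x.
Proof.
move=> mD mf f0.
have mid : measurable_fun [set: caratheodory_type (mu_ext mu)]
    (id : caratheodory_type (mu_ext mu) -> measurableTypeR R).
  by move=> _ A mA; rewrite setTI; exact: caratheodory_measurable_mu_ext.
rewrite (ge0_integral_density (la := muc) (r := cst 1%R) mid)//.
- by apply: eq_integral => x _; rewrite /= mule1.
- move=> A mA _; transitivity (\int[muc]_(x in A) cst 1 x); last exact: eq_integral.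
  rewrite integral_cst ?mul1e; first by rewrite -(completionE mu mA).
  exact: caratheodory_measurable_mu_ext.
Qed.

Section version.
Variables (D Z : set (measurableTypeR R)) (w v : R -> R).
Hypotheses (mD : measurable D) (mZ : measurable Z) (Z0 : mu Z = 0).
Hypothesis mw : measurable_fun D (w : measurableTypeR R -> R).
Hypothesis wv : forall x, D x -> ~ Z x -> w x = v x.

Let mcara (A : set (measurableTypeR R)) : measurable A ->
  measurable (A : set (caratheodory_type (mu_ext mu))).
Proof. exact: caratheodory_measurable_mu_ext. Qed.

Let mwc : measurable_fun (D : set (caratheodory_type (mu_ext mu))) (EFin \o w).
Proof.
by move=> _ B mB; apply: mcara; move/measurable_EFinP : mw; exact.
Qed.

Let ae_wv : ae_eq muc D (EFin \o w) (EFin \o v).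
Proof.
exists Z; split=> //; [exact: mcara|by rewrite -Z0 -(completionE mu mZ)|].
by move=> x /= /not_implyP[Dx]; apply: contra_notP => nZx; rewrite wv.
Qed.

(** Completeness of [muc] transfers measurability from [w] to a function that agrees with it almost
    everywhere. *)
Let mvc : measurable_fun (D : set (caratheodory_type (mu_ext mu))) (EFin \o v).
Proof.
by apply: ae_measurable_fun ae_wv mwc => //; exact: completion_is_complete.
Qed.

Lemma completion_integrableE :
  mu.-integrable D (EFin \o w) <-> muc.-integrable D (EFin \o v).
Proof.
have E : \int[muc]_(x in D) `|(v x)%:E| = \int[mu]_(x in D) `|(w x)%:E|.
  rewrite -ge0_integral_completion//; last first.
    by apply: measurableT_comp => //; exact/measurable_EFinP.
  have mabs (f : R -> R) :
      measurable_fun (D : set (caratheodory_type (mu_ext mu))) (EFin \o f) ->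
      measurable_fun (D : set (caratheodory_type (mu_ext mu)))
        (fun x => `|(f x)%:E|) by move=> ?; exact: measurableT_comp.
  apply: (ge0_ae_eq_integral (mcara mD) (mabs _ mvc) (mabs _ mwc)).
  - by move=> x _; exact: abse_ge0.
  - by move=> x _; exact: abse_ge0.
  - by apply: ae_eq_abse; exact: ae_eq_sym.
split=> /integrableP[_]; rewrite /= ?E => fin; apply/integrableP; split=> //=.
  by rewrite E.
exact/measurable_EFinP.
Qed.

Lemma completion_integralE :
  \int[muc]_(x in D) (v x)%:E = \int[mu]_(x in D) (w x)%:E.
Proof.
have -> : \int[muc]_(x in D) (v x)%:E = \int[muc]_(x in D) (w x)%:E.
  by apply: ae_eq_integral => //; [exact: mcara|exact: ae_eq_sym].
have mwE : measurable_fun D (EFin \o (w : measurableTypeR R -> R)).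
  exact/measurable_EFinP.
rewrite integralE [RHS]integralE; congr (_ - _).
- by apply: ge0_integral_completion => //; exact: measurable_funepos.
- by apply: ge0_integral_completion => //; exact: measurable_funeneg.
Qed.

End version.

End completion_versions.

(** * Absolute continuity and bounded variation *)

Section gac.
Context (R : realType) (a b : R).
Implicit Types g u : R -> R.

(* The (e, dlt) clause of ACg for one component. *)
Definition gac g u (e dlt : R) : Prop :=
  forall (n : nat) (s t : 'I_n -> R),
    (forall j, [/\ a <= s j, s j < t j & t j <= b]) ->
    trivIset [set: 'I_n] (fun j => `[s j, t j[%classic) ->
    \sum_(j < n) (g (t j) - g (s j)) < dlt ->
    \sum_(j < n) `|u (t j) - u (s j)| < e.

Definition gAC g u : Prop :=
  forall e : R, 0 < e -> exists2 dlt : R, 0 < dlt & gac g u e dlt.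

(** Degenerate intervals contribute nothing to either sum and are dropped; the others are
    renumbered. Partitions give families indexed by dependent pairs, and clamped intervals may be
    empty, so both extensions are used below. *)
Lemma gac_fin g u e dlt (I : finType) (s t : I -> R) : gac g u e dlt ->
  (forall j, [/\ a <= s j, s j <= t j & t j <= b]) ->
  trivIset [set: I] (fun j => `[s j, t j[%classic) ->
  \sum_j (g (t j) - g (s j)) < dlt ->
  \sum_j `|u (t j) - u (s j)| < e.
Proof.
move=> gu st tst; pose A := [set j | s j < t j]%SET.
have dropA (h : I -> R) : (forall j, t j = s j -> h j = 0) ->
    \sum_j h j = \sum_(j < #|A|) h (enum_val j).
  move=> h0; rewrite (bigID (mem A))/= [X in _ + X]big1 ?addr0 => [|j].
    by rewrite big_enum_val.
  have [_ stj _] := st j; rewrite inE -leNgt => tsj; apply: h0.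
  by apply/le_anti; rewrite tsj.
rewrite (dropA (fun j => g (t j) - g (s j))) => [|j ->]; last by rewrite subrr.
rewrite (dropA (fun j => `|u (t j) - u (s j)|)) => [|j ->]; last first.
  by rewrite subrr normr0.
apply: gu => [j|].
  by have [? _ ?] := st (enum_val j); split=> //; have := enum_valP j; rewrite inE.
apply/trivIsetP => i j _ _ ij; move/trivIsetP : tst; apply => //.
by apply: contra_neq ij; exact: enum_val_inj.
Qed.

Lemma gac1 g u e dlt x y : gac g u e dlt -> a <= x -> x <= y -> y <= b ->
  g y - g x < dlt -> `|u y - u x| < e.
Proof.
move=> gu ax xy yb gxy.
have := @gac_fin g u e dlt unit (fun=> x) (fun=> y) gu.
rewrite !big_const !card_unit/= !addr0; apply => //.
by apply/trivIsetP => -[] [].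
Qed.

Lemma itv_partition_nth_homo (x y : R) (l : seq R) i j : itv_partition x y l ->
  (i <= j)%N -> (j <= size l)%N -> nth y (x :: l) i <= nth y (x :: l) j.
Proof.
move=> [xl _] ij jl; apply: (@sorted_leq_nth _ <=%R) => //.
- exact: le_trans.
- by rewrite /= (sub_path _ xl)// => ? ?; exact: ltW.
- by rewrite inE/= ltnS (leq_trans ij).
Qed.

(** All subintervals of all the partitions form one disjoint family, indexed by pairs. As [g] is
    nondecreasing, its increments over this family add up to the original sum, so the same [dlt]
    applies. *)
Lemma gac_variations g u e dlt n (s t : 'I_n -> R) (l : 'I_n -> seq R) :
  {in `[a, b] &, {homo g : x y / x <= y}} ->
  gac g u e dlt ->
  (forall j, [/\ a <= s j, s j < t j & t j <= b]) ->
  trivIset [set: 'I_n] (fun j => `[s j, t j[%classic) ->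
  (forall j, itv_partition (s j) (t j) (l j)) ->
  \sum_(j < n) (g (t j) - g (s j)) < dlt ->
  \sum_(j < n) variation (s j) (t j) u (l j) < e.
Proof.
move=> ndg gu st tst pl gst.
have E (f : R -> R) : \sum_(j < n) variation (s j) (t j) f (l j) =
    \sum_(p : {j : 'I_n & 'I_(size (l j))})
      `|f (nth (t (tag p)) (s (tag p) :: l (tag p)) (tagged p).+1) -
        f (nth (t (tag p)) (s (tag p) :: l (tag p)) (tagged p))|.
  rewrite (eq_bigr (fun j => \sum_(i < size (l j))
    `|f (nth (t j) (s j :: l j) i.+1) - f (nth (t j) (s j :: l j) i)|)); last first.
    by move=> j _; rewrite /variation big_mkord.
  by rewrite sig_big_dep.
have bd p q : itv_partition (s p) (t p) (l p) -> (q <= size (l p))%N ->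
    a <= nth (t p) (s p :: l p) q <= b.
  move=> plp qp; have [asp _ tpb] := st p.
  rewrite (le_trans asp (itv_partition_nth_ge _ plp))//=.
  by rewrite (le_trans (itv_partition_nth_le _ plp)).
rewrite E; apply: (gac_fin gu).
- move=> [j i]/=; split.
  + by have /andP[] := bd j i (pl j) (ltnW (ltn_ord i)).
  + exact: (itv_partition_nth_homo (pl j) (leqnSn i) (ltn_ord i)).
  + by have /andP[] := bd j i.+1 (pl j) (ltn_ord i).
- apply/trivIsetP => -[j i] [j' i'] _ _ /= ij.
  rewrite -subset0 => z/= []; rewrite !in_itv/= => /andP[z1 z2] /andP[z3 z4].
  have [jj'|jj'] := eqVneq j j'.
    subst j'; have ii' : i != i' by apply: contra_neq ij => ->.
    have := ii'; rewrite neq_ltn => /orP[ii|ii].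
      have := itv_partition_nth_homo (pl j) ii (ltnW (ltn_ord i')).
      by move=> /(lt_le_trans z2)/lt_le_trans/(_ z3); rewrite ltxx.
    have := itv_partition_nth_homo (pl j) ii (ltnW (ltn_ord i)).
    by move=> /(lt_le_trans z4)/lt_le_trans/(_ z1); rewrite ltxx.
  move/trivIsetP : tst => /(_ j j' I I jj'); rewrite -subset0; apply.
  exists; rewrite /= in_itv/=; apply/andP; split.
  + exact: le_trans (itv_partition_nth_ge (ltnW (ltn_ord i)) (pl j)) z1.
  + exact: lt_le_trans z2 (@itv_partition_nth_le _ _ _ _ _ i.+1 (ltn_ord i) (pl j)).
  + exact: le_trans (itv_partition_nth_ge (ltnW (ltn_ord i')) (pl j')) z3.
  + exact: lt_le_trans z4 (@itv_partition_nth_le _ _ _ _ _ i'.+1 (ltn_ord i') (pl j')).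
- apply: (@le_lt_trans _ _ (\sum_(j < n) (g (t j) - g (s j)))) => //.
  rewrite le_eqVlt; apply/orP; left; apply/eqP.
  transitivity (\sum_(j < n) variation (s j) (t j) g (l j)).
    rewrite E; apply: eq_bigr => -[j i] _ /=; rewrite ger0_norm// subr_ge0.
    apply: ndg; rewrite ?in_itv/=; [exact/bd/ltnW|exact: (bd j i.+1 (pl j) (ltn_ord i))|].
    exact: (itv_partition_nth_homo (pl j) (leqnSn i) (ltn_ord i)).
  apply: eq_bigr => j _; rewrite nondecreasing_variation// => x y.
  have [asj _ tjb] := st j.
  rewrite !in_itv/= => /andP[sx xt] /andP[sy yt] xy; apply: ndg => //.
  + by rewrite in_itv/= (le_trans asj)//= (le_trans xt).
  + by rewrite in_itv/= (le_trans asj)//= (le_trans yt).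
Qed.

Lemma gac_variation g u e dlt x y l :
  {in `[a, b] &, {homo g : x y / x <= y}} -> 0 < e ->
  gac g u e dlt -> a <= x -> y <= b -> itv_partition x y l ->
  g y - g x < dlt -> variation x y u l < e.
Proof.
move=> ndg e0 gu ax yb pl gxy.
have := itv_partition_le pl; rewrite le_eqVlt => /predU1P[xy|xy].
  by move: pl; rewrite xy => /itv_partitionxx ->; rewrite variation_nil.
have := @gac_variations g u e dlt 1 (fun=> x) (fun=> y) (fun=> l) ndg gu.
rewrite !big_ord1; apply => //.
by apply/trivIsetP => i j _ _; rewrite (ord1 i) (ord1 j) eqxx.
Qed.
End gac.

Section gac_bounded_variation.
Context (R : realType) (a b : R) (g : derivator a b) (u : R -> R).
Hypotheses (ab : a < b) (gu : gAC a b g u).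
Local Notation finTV x y := (total_variation x y u \is a fin_num).

Let finTV_of_bound x y M : x <= y ->
  (forall l, itv_partition x y l -> variation x y u l <= M) -> finTV x y.
Proof.
by move=> xy H; apply/bounded_variationP => //; exists M => _ [l pl <-]; exact: H.
Qed.

Lemma gac_left_continuous t : a < t -> t <= b -> u x @[x --> t^'-] --> u t.
Proof.
move=> at_ tb; apply/cvgrPdist_lt => e e0.
have [dlt d0 gud] := gu e0.
have /cvgrPdist_lt/(_ _ d0) := derivator_left_continuous g at_ tb.
move=> gt; near=> x.
have ax : a <= x by near: x; exact: nbhs_left_ge.
have xt : x <= t by near: x; exact: nbhs_left_le.
apply: (gac1 gud) => //; apply: le_lt_trans (ler_norm _) _.
by near: x.
Unshelve. all: by end_near. Qed.

Let finTV_left c dlt : 0 < dlt -> gac a b g u 1 dlt -> a < c -> c <= b ->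
  exists2 x, a <= x < c & forall y, x <= y <= c -> finTV y c.
Proof.
move=> d0 gud ac cb.
have /cvgrPdist_lt/(_ _ d0) gc := derivator_left_continuous g ac cb.
have : \forall x \near c^'-, [/\ a <= x, x < c & `|g c - g x| < dlt].
  near=> x; split; [|near: x; exact: nbhs_left_lt|by near: x].
  by near: x; exact: nbhs_left_ge.
move=> /filter_ex[x [ax xc gxc]]; exists x; first by rewrite ax.
move=> y /andP[xy yc]; have ay := le_trans ax xy.
apply: (@finTV_of_bound _ _ 1) => // l pl; apply/ltW.
apply: (gac_variation (@derivator_nondecreasing _ _ _ g) _ gud) => //.
apply: le_lt_trans gxc; apply: le_trans (ler_norm _); rewrite lerB//.
apply: derivator_nondecreasing => //; rewrite in_itv/= ?ax ?ay/=.
  by rewrite (le_trans xy)// (le_trans yc).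
by rewrite (le_trans yc).
Unshelve. all: by end_near. Qed.

(** [g] may jump at [c], so smallness is only available on []c, y]]: [y] is chosen with [g y] within
    [dlt] of the infimum of [g] on []c, b]]. *)
Let finTV_right c dlt : 0 < dlt -> gac a b g u 1 dlt -> a <= c -> c < b ->
  exists2 y, c < y <= b & finTV c y.
Proof.
move=> d0 gud ac cb; pose A := [set g x | x in `]c, b]].
have homg x y : a <= x -> x <= y -> y <= b -> g x <= g y.
  move=> ax xy yb; apply: derivator_nondecreasing => //; rewrite in_itv/=.
    by rewrite ax (le_trans xy).
  by rewrite yb (le_trans ax).
have infA : has_inf A.
  split; first by exists (g b), b => //=; rewrite in_itv/= cb lexx.
  exists (g c) => _ [x /= +] <-; rewrite in_itv/= => /andP[cx xb].
  by apply: homg => //; exact: ltW.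
have [_ [y /= + <-] gy] := inf_adherent d0 infA.
rewrite in_itv/= => /andP[cy yb]; exists y; first by rewrite cy.
have small x : c < x -> x <= y -> g y - g x < dlt.
  move=> cx xy; rewrite ltrBlDl (lt_le_trans gy)// lerD2r.
  apply: ge_inf; first exact: infA.2.
  by exists x => //=; rewrite in_itv/= cx (le_trans xy).
(* The first step of a partition crosses the possible jump at [c]; comparison with [u y] bounds it
   by [|u y - u c| + 1]. The steps after it add at most [1]. *)
apply: (@finTV_of_bound _ _ (`|u y - u c| + 1 + 1)); first exact: ltW.
move=> [|x l]; first by rewrite variation_nil => _; rewrite !addr_ge0.
move=> pl; have pl' := itv_partition_cons pl.
have cx : c < x by case: pl => /= /andP[].
have xy := itv_partition_le pl'.
have ax : a <= x by rewrite (le_trans ac)// ltW.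
rewrite -[x :: l]/([:: x] ++ l) (variation_cat (c := x))//; last 2 first.
  exact: ltW.
  exact: itv_partition1.
rewrite lerD//; last first.
  apply/ltW/(gac_variation (@derivator_nondecreasing _ _ _ g) _ gud) => //.
  exact: small.
rewrite /variation/= big_nat1/=.
have -> : u x - u c = (u y - u c) - (u y - u x) by ring.
rewrite (le_trans (ler_normB _ _))// lerD2l ltW//.
by apply: (gac1 gud) => //; exact: small.
Qed.

(** A supremum argument: let [c] be the supremum of the points up to which the variation is finite.
    By [finTV_left], [c] is one of them, and [finTV_right] would go beyond [c] if [c < b]. *)
Lemma gac_bounded_variation : bounded_variation a b u.
Proof.
have [dlt d0 gud] := gu (@ltr01 R).
pose S := [set x | a <= x <= b /\ finTV a x].
have Sa : S a by split; rewrite ?lexx ?ltW// total_variationxx.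
have supS : has_sup S by split; [exists a|exists b => x [/andP[]]].
pose c := sup S.
have ac : a <= c by apply: ub_le_sup => //; exact: supS.2.
have cb : c <= b by apply: ge_sup; [exact: supS.1|move=> x [/andP[]]].
have Sc : finTV a c.
  move: ac; rewrite le_eqVlt => /predU1P[<-|ac]; first by rewrite total_variationxx.
  have [x /andP[ax xc] xP] := finTV_left d0 gud ac cb.
  have /sup_adherent/(_ supS)[y [/andP[ay yb] Sy]] : 0 < c - x by rewrite subr_gt0.
  rewrite opprB addrCA subrr addr0 => xy.
  have yc : y <= c by apply: ub_le_sup; [exact: supS.2|split=> //; rewrite ay].
  rewrite (total_variationD u ay yc) fin_numD Sy xP//.
  by rewrite yc (ltW xy).
move: cb; rewrite le_eqVlt => /predU1P[<-|cb].
  by apply/bounded_variationP.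
have [y /andP[cy yb] fy] := finTV_right d0 gud ac cb.
have : S y.
  split; first by rewrite yb (le_trans ac)// ltW.
  by rewrite (total_variationD u ac (ltW cy)) fin_numD Sc.
by move/(ub_le_sup supS.2); rewrite leNgt cy.
Qed.

Lemma fin_num_total_variation x y : a <= x -> x <= y -> y <= b -> finTV x y.
Proof.
move=> ax xy yb; apply/bounded_variationP => //.
apply: (bounded_variationl xy yb).
exact: (bounded_variationr ax (le_trans xy yb) gac_bounded_variation).
Qed.

Definition gac_tv (x : R) : R := fine (total_variation a x u).

Lemma gac_tvB x y : a <= x -> x <= y -> y <= b ->
  gac_tv y - gac_tv x = fine (total_variation x y u).
Proof.
move=> ax xy yb; rewrite /gac_tv (total_variationD u ax xy).
rewrite fineD ?fin_num_total_variation ?(le_trans xy)//.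
by rewrite addrC addKr.
Qed.

(** Each total variation is nearly attained by a partition, so [gac_variations] applies up to a
    small error. *)
Lemma gac_tvP : gAC a b g gac_tv.
Proof.
move=> e e0; have e2 : 0 < e / 2 by rewrite divr_gt0.
have [dlt d0 gud] := gu e2; exists dlt => // n s t st tst gst.
(* The error [r] below is an equal share of [e / 2] among the [n] intervals, so [n] has to be
   positive. *)
have [n0|n0] := posnP n.
  rewrite big1// => j; exfalso.
  by have := ltn_ord j; rewrite [X in (_ < X)%N]n0.
have TVE j : `|gac_tv (t j) - gac_tv (s j)| =
    fine (total_variation (s j) (t j) u).
  have [asj sj tj] := st j.
  rewrite gac_tvB ?(ltW sj)// ger0_norm// fine_ge0//.
  exact/total_variation_ge0/ltW.
pose r := e / 2 / n%:R.
have r0 : 0 < r by rewrite divr_gt0// ltr0n.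
have /choice[l lP] (j : 'I_n) : exists l, itv_partition (s j) (t j) l /\
    fine (total_variation (s j) (t j) u) <= variation (s j) (t j) u l + r.
  have [asj sj tj] := st j.
  have ft := fin_num_total_variation asj (ltW sj) tj.
  have [_ [_ [l pl <-] <-] H] := ub_ereal_sup_adherent r0 ft.
  exists l; split => //; rewrite -lerBlDr -lee_fin EFinB fineK//.
  exact: ltW.
rewrite (eq_bigr _ (fun j _ => TVE j)).
apply: (@le_lt_trans _ _ (\sum_(j < n) (variation (s j) (t j) u (l j) + r))).
  by apply: ler_sum => j _; have [] := lP j.
rewrite big_split/= [e]splitr ltr_leD//.
  apply: (gac_variations (@derivator_nondecreasing _ _ _ g) gud) => // j.
  by have [] := lP j.
by rewrite sumr_const card_ord /r -[leLHS]mulr_natr divfK// pnatr_eq0 -lt0n.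
Qed.

Lemma gac_tv_nd : {in `[a, b] &, {homo gac_tv : x y / x <= y}}.
Proof.
move=> x y; rewrite !in_itv/= => /andP[ax xb] /andP[ay yb] xy.
by rewrite -subr_ge0 gac_tvB// fine_ge0// total_variation_ge0.
Qed.

Lemma gac_tvB_nd :
  {in `[a, b] &, {homo (fun x => gac_tv x - u x) : x y / x <= y}}.
Proof.
move=> x y; rewrite !in_itv/= => /andP[ax xb] /andP[ay yb] xy.
rewrite -subr_ge0.
have -> : gac_tv y - u y - (gac_tv x - u x) =
    (gac_tv y - gac_tv x) - (u y - u x) by ring.
rewrite subr_ge0 gac_tvB//.
rewrite (le_trans (ler_norm _))// -lee_fin fineK ?fin_num_total_variation//.
exact: total_variation_ge.
Qed.

Lemma gac_tv_lc t : a < t -> t <= b -> gac_tv x @[x --> t^'-] --> gac_tv t.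
Proof.
move=> at_ tb; have lc := gac_left_continuous at_ tb.
exact: total_variation_left_continuous at_ tb lc gac_bounded_variation.
Qed.

Lemma gac_tvB_lc t : a < t -> t <= b ->
  gac_tv x - u x @[x --> t^'-] --> gac_tv t - u t.
Proof.
move=> at_ tb; apply: cvgB; first exact: gac_tv_lc.
exact: gac_left_continuous.
Qed.

(** The two monotone parts of [u]. As derivators they have Stieltjes measures, whose difference
    serves as the derivative measure of [u]. *)
Definition gac_pos : derivator a b := Derivator gac_tv_nd gac_tv_lc.
Definition gac_neg : derivator a b := Derivator gac_tvB_nd gac_tvB_lc.

Lemma gac_pos_negE x : u x = gac_pos x - gac_neg x.
Proof. by rewrite /= opprB addrCA subrr addr0. Qed.

Lemma gac_posP : gAC a b g gac_pos. Proof. exact: gac_tvP. Qed.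

Lemma gac_negP : gAC a b g gac_neg.
Proof.
move=> e e0; have e2 : 0 < e / 2 by rewrite divr_gt0.
have [d1 d10 gud1] := gac_tvP e2; have [d2 d20 gud2] := gu e2.
exists (Num.min d1 d2); first by rewrite lt_min d10.
move=> n s t st tst; rewrite lt_min => /andP[g1 g2].
apply: (@le_lt_trans _ _ (\sum_(j < n)
    (`|gac_tv (t j) - gac_tv (s j)| + `|u (t j) - u (s j)|))).
  apply: ler_sum => j _ /=.
  have -> : gac_tv (t j) - u (t j) - (gac_tv (s j) - u (s j)) =
    (gac_tv (t j) - gac_tv (s j)) - (u (t j) - u (s j)) by ring.
  exact: ler_normB.
rewrite big_split/= [e]splitr ltrD//; [exact: gud1|exact: gud2].
Qed.

End gac_bounded_variation.

(** * Domination of Stieltjes measures *)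

Section gac_dominates.
Context (R : realType) (a b : R) (g h : derivator a b).
Hypothesis ab : a <= b.

Lemma clamp_ge x : a <= clamp a b x. Proof. by rewrite /clamp le_max lexx. Qed.

Lemma clamp_le x : clamp a b x <= b.
Proof. by rewrite /clamp ge_max ab ge_min lexx. Qed.

Lemma clamp_homo : {homo clamp a b : x y / x <= y}.
Proof.
move=> x y xy; rewrite /clamp ge_max le_max lexx/= le_max; apply/orP; right.
by rewrite le_min !ge_min lexx/= xy orbT.
Qed.

Lemma clamp_le_id x z : a <= x -> x < b -> (clamp a b z <= x) = (z <= x).
Proof. by move=> ax xb; rewrite /clamp ge_max ax/= ge_min [b <= x]leNgt xb. Qed.

Lemma clamp_lt_id x z : a <= x -> x < b -> (x < clamp a b z) = (x < z).
Proof.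
by move=> ax xb; rewrite /clamp lt_max ltNge ax/= lt_min xb.
Qed.

(** A set of the ring is a finite disjoint union of intervals []x, y]], and its measure is the sum
    of the increments of [g] over their mirror images, clamped to [[a, b]]. These form an admissible
    family for [gac]. *)
Lemma lebesgue_stieltjes_ring_le (e dlt : R) (E : set R) :
  gac a b g h e dlt ->
  measurable (E : set (SetRing.type (ocitv_type R))) ->
  (lebesgue_stieltjes_measure (reflected g) E < dlt%:E)%E ->
  (lebesgue_stieltjes_measure (reflected h) E <= e%:E)%E.
Proof.
move=> gh mE.
pose D : seq (set R) := finmap.enum_fset
  (fset_set (SetRing.decomp (E : set (SetRing.type (ocitv_type R))))).
have finD := @SetRing.decomp_finite_set _ (ocitv_type R) E.
have LSE (f : derivator a b) : lebesgue_stieltjes_measure (reflected f) E =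
    (\sum_(i < size D) wlength (reflected f) (nth set0 D i))%E.
  have -> : lebesgue_stieltjes_measure (reflected f) E =
      SetRing.measure (wlength (reflected f)) E.
    exact: (measurable_Rmu_extE (wlength (reflected f)) mE).
  by rewrite /SetRing.measure fsbig_finite//= (big_nth set0) big_mkord.
have inD (i : 'I_(size D)) : SetRing.decomp
    (E : set (SetRing.type (ocitv_type R))) (nth set0 D i).
  have : nth set0 D i \in D by exact: mem_nth.
  by rewrite (in_fset_set finD) inE.
have /choice[x /choice[y xyP]] (i : 'I_(size D)) :
    exists x y : R, x <= y /\ nth set0 D i = `]x, y]%classic.
  have /ocitvP[->|[[x y]/= xy ->]] : ocitv (nth set0 D i).
    by apply: (SetRing.decomp_measurable mE); rewrite inE; exact: inD.
  - by exists 0, 0; split => //; rewrite set_itv_ge// bnd_simp ltxx.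
  - by exists x, y; split=> //; exact: ltW.
pose s i := clamp a b (- y i); pose t i := clamp a b (- x i).
have wE (f : derivator a b) (i : 'I_(size D)) :
    wlength (reflected f) (nth set0 D i) = (f (t i) - f (s i))%:E.
  have [xy ->] := xyP i; rewrite wlength_itv_bnd// /reflected.
  by rewrite opprK addrC.
rewrite !LSE; under eq_bigr do rewrite wE.
under [X in _ -> (X <= _)%E]eq_bigr do rewrite wE.
rewrite !sumEFin lte_fin lee_fin => gst; apply/ltW.
apply: le_lt_trans (gac_fin gh _ _ gst).
- by apply: ler_sum => i _; exact: ler_norm.
- move=> i; split; [exact: clamp_ge| |exact: clamp_le].
  by apply: clamp_homo; rewrite lerN2; have [] := xyP i.
(* A common point [z] of two clamped intervals lies in [[a, b[], where clamping does not affect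
   comparisons, so [- z] would lie in two distinct pieces of the decomposition. *)
- apply/trivIsetP => i j _ _ ij; rewrite -subset0 => z/= [].
  rewrite !in_itv/= => /andP[z1 z2] /andP[z3 z4].
  have az : a <= z := le_trans (clamp_ge _) z1.
  have zb : z < b := lt_le_trans z2 (clamp_le _).
  move: z1 z2 z3 z4; rewrite !clamp_le_id// !clamp_lt_id// => z1 z2 z3 z4.
  have := @SetRing.decomp_triv _ (ocitv_type R) E _ _ (inD i) (inD j).
  suff : (nth set0 D i `&` nth set0 D j) !=set0.
    move=> /[swap] /[apply] /eqP; rewrite nth_uniq ?finmap.fset_uniq//.
    by move/eqP/val_inj/eqP; rewrite (negbTE ij).
  exists (- z); rewrite (xyP i).2 (xyP j).2 /= !in_itv/=.
  by split; apply/andP; split; rewrite 1?ltrNr 1?lerNl.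
Qed.

(** A null set for [g] is covered by countably many half-open intervals of total mass below [dlt].
    Absolute continuity controls finite unions only, so the bound [e] is obtained for the partial
    unions [G n] and passed to the limit by continuity from below. *)
Lemma gAC_stieltjes_dominates : gAC a b g h ->
  stieltjes_measure h `<< stieltjes_measure g.
Proof.
move=> gh; apply/null_content_dominatesP => A mA; rewrite /stieltjes_measure /=.
rewrite /mfrestr /mrestr /mirror_measure /pushforward /=.
set B := _ @^-1` _ => gB; apply/eqP; rewrite eq_le measure_ge0 andbT.
apply/lee_addgt0Pr => _/posnumP[e]; rewrite add0e.
have [dlt d0 ghd] := gh _ [gt0 of e%:num].
have : (mu_ext (wlength (reflected g)) B < dlt%:E)%E.
  by rewrite [X in (X < _)%E]gB lte_fin.
move=> /ereal_inf_lt[_ [F [mF BF] <-]] Fd.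
have mFR k : measurable (F k : set (measurableTypeR R)).
  exact: sub_sigma_algebra (mF k).
pose G n := \big[setU/set0]_(k < n) F k.
have mGring n : measurable (G n : set (SetRing.type (ocitv_type R))).
  by apply: bigsetU_measurable => k _; exact: sub_gen_smallest.
have mG n : measurable (G n : set (measurableTypeR R)).
  exact: bigsetU_measurable.
have GF n : G n `<=` \bigcup_k F k.
  by rewrite /G -bigcup_mkord => z [k _ ?]; exists k.
have LSG n : (lebesgue_stieltjes_measure (reflected h) (G n) <= e%:num%:E)%E.
  apply: (lebesgue_stieltjes_ring_le ghd) => //.
  (* [F] covers [G n] too, so the outer measure of [G n] is at most the total mass of [F]. *)
  apply: le_lt_trans Fd.
  by apply: ereal_inf_lbound; exists F => //; split => //; exact: GF.
have mB : measurable (B : set (measurableTypeR R)).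
  rewrite /B -[X in measurable X]setTI.
  by apply: oppr_measurable => //; apply: measurableI => //; exact: measurable_itv.
apply: (@le_trans _ _ (lebesgue_stieltjes_measure (reflected h) (\bigcup_n G n))).
  apply: le_measure; rewrite ?inE//; first exact: bigcupT_measurable.
  by move=> z /BF[k _ Fkz]; exists k.+1 => //; rewrite /G big_ord_recr; right.
have cvgG : lebesgue_stieltjes_measure (reflected h) (G n) @[n --> \oo] -->
    lebesgue_stieltjes_measure (reflected h) (\bigcup_n G n).
  apply: (@nondecreasing_cvg_mu _ _ _
    (lebesgue_stieltjes_measure (reflected h)) G mG (bigcupT_measurable _ mG)).
  by move=> m n mn; apply/subsetPset; exact: subset_bigsetU.
rewrite -(cvg_lim _ cvgG)//; apply: lime_le; last exact: nearW.
by apply/cvg_ex; eexists; exact: cvgG.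
Qed.
End gac_dominates.

(** * Charges determined by intervals *)

(** Trades an equality of differences of measures for an equality of sums, to which results on
    positive measures apply. *)
Lemma sube_eq_cross (R : realDomainType) (x y z t : \bar R) :
  x \is a fin_num -> y \is a fin_num -> z \is a fin_num -> t \is a fin_num ->
  (x - y = z - t <-> x + t = z + y)%E.
Proof.
move=> /fineK <- /fineK <- /fineK <- /fineK <-.
by rewrite -!EFinN -!EFinD; split=> -[] e; congr EFin; lra.
Qed.

Section intervals_co.
Context (R : realType) (a b : R).
Local Notation mR := (measurableTypeR R).
Local Open Scope ereal_scope.

(** Both measures are restricted to [[a, b[] and compared on the rays []-oo, x[], which are stable
    under intersection, generate the Borel sets and have traces [[a, clamp a b x[]. *)
Lemma measure_eq_co (m1 m2 : {measure set mR -> \bar R}) :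
  m1 `[a, b[%classic < +oo ->
  (forall s t : R, (a <= s)%R -> (s <= t)%R -> (t <= b)%R ->
    m1 `[s, t[%classic = m2 `[s, t[%classic) ->
  forall A : set mR, measurable A -> A `<=` `[a, b[%classic -> m1 A = m2 A.
Proof.
move=> m1oo m12 A mA Aab.
have [ab|ba] := leP a b; last first.
  suff -> : A = set0 by rewrite !measure0.
  rewrite -subset0 => x /Aab/=; rewrite in_itv/= => /andP[ax xb].
  by have := lt_trans (le_lt_trans ax xb) ba; rewrite ltxx.
have mab : measurable (`[a, b[%classic : set mR) by exact: measurable_itv.
pose r1 : {measure set mR -> \bar R} := mrestr m1 mab.
pose r2 : {measure set mR -> \bar R} := mrestr m2 mab.
suff : r1 A = r2 A by rewrite /r1 /r2 /= /mrestr setIidl.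
apply: (@measure_unique _ R mR (@RGenInftyO.G R) (fun n => `]-oo, (n%:R : R)[%classic)).
- exact: RGenInftyO.measurableE.
- move=> _ _ [x ->] [y ->]; exists (Num.min x y).
  by apply/seteqP; split=> z /=; rewrite !in_itv/= lt_min => /andP.
- by move=> n; exists n%:R.
- apply/seteqP; split=> // x _; exists (Num.truncn x).+1 => //=.
  by rewrite in_itv/= truncnS_gt.
- move=> _ [x ->]; rewrite /r1 /r2 /= /mrestr.
  have -> : `]-oo, x[%classic `&` `[a, b[%classic = `[a, clamp a b x[%classic.
    apply/seteqP; split=> z /=; rewrite !in_itv/=.
      by move=> [zx /andP[az zb]]; rewrite az clamp_lt_id.
    move=> /andP[az zc]; have zb := lt_le_trans zc (clamp_le ab _).
    by move: zc; rewrite clamp_lt_id// az zb.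
  by apply: m12; rewrite ?clamp_ge ?clamp_le.
- move=> n; rewrite /r1 /= /mrestr; apply: le_lt_trans m1oo.
  apply: le_measure; rewrite ?inE; [|exact: mab|exact: subIsetr].
  by apply: measurableI; [exact: measurable_itv|exact: mab].
- exact: mA.
Qed.

(** By Jordan decomposition, [n1 A = n2 A] amounts to an equality between two finite positive
    measures, each the sum of the positive part of one charge and the negative part of the other. *)
Lemma charge_eq_co (n1 n2 : {charge set mR -> \bar R}) :
  (forall s t : R, (a <= s)%R -> (s <= t)%R -> (t <= b)%R ->
    n1 `[s, t[%classic = n2 `[s, t[%classic) ->
  forall A : set mR, measurable A -> A `<=` `[a, b[%classic -> n1 A = n2 A.
Proof.
move=> n12.
have [P1 [N1 H1]] := Hahn_decomposition n1.
have [P2 [N2 H2]] := Hahn_decomposition n2.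
have iff A : measurable A -> n1 A = n2 A <->
    measure_add (jordan_pos H1) (jordan_neg H2) A =
    measure_add (jordan_pos H2) (jordan_neg H1) A.
  move=> mA; rewrite !measure_addE (jordan_decomp H1 mA) (jordan_decomp H2 mA).
  by rewrite /cadd/= cscaleN1 cscaleN1; apply: sube_eq_cross; exact: fin_num_measure.
move=> A mA Aab; apply/(iff _ mA).
apply: measure_eq_co Aab => //.
  rewrite [ltLHS]measure_addE ltey_eq fin_numD !fin_num_measure//;
    exact: measurable_itv.
move=> s t as_ st tb; apply/iff; first exact: measurable_itv.
exact: n12.
Qed.
End intervals_co.

(** * Densities with respect to [g] and the representation of charges *)

Section scalar_derivative.
Context (R : realType) (a b : R) (g : derivator a b) (ab : (a < b)%R).
Local Notation mR := (measurableTypeR R).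
Local Notation mug := (stieltjes_measure g).
Local Open Scope ereal_scope.

Lemma gAC_density (h : derivator a b) : gAC a b g h ->
  exists f : mR -> R, mug.-integrable [set: mR] (EFin \o f) /\
    forall A : set mR, measurable A ->
      stieltjes_measure h A = \int[mug]_(x in A) (f x)%:E.
Proof.
move=> gh; pose nu := charge_of_finite_measure (stieltjes_measure h).
have dom : nu `<< mug by exact: gAC_stieltjes_dominates (ltW ab) gh.
pose f := Radon_Nikodym nu mug.
have fE x : f x = (fine (f x))%:E.
  by rewrite fineK//; exact: Radon_Nikodym_fin_num.
exists (fine \o f); split.
- exact: eq_integrable (Radon_Nikodym_integrable dom).
- move=> A mA; apply: etrans (Radon_Nikodym_integral dom mA) _.
  by apply: eq_integral => x _; exact: fE.
Qed.

Lemma gAC_derivative (u : R -> R) : gAC a b g u ->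
  exists2 w : mR -> R, mug.-integrable [set: mR] (EFin \o w) &
    forall t : R, (a <= t)%R -> (t <= b)%R ->
      (u t)%:E = (u a)%:E + \int[mug]_(x in `[a, t[) (w x)%:E.
Proof.
move=> gu; have [f [fi fE]] := gAC_density (gac_posP ab gu).
have [k [ki kE]] := gAC_density (gac_negP ab gu).
exists (fun x => f x - k x)%R.
  by apply: eq_integrable (integrableB _ fi ki).
move=> t at_ tb; have mt : measurable (`[a, t[%classic : set mR).
  exact: measurable_itv.
under eq_integral do rewrite EFinB.
rewrite integralB; [|exact: mt|exact: integrableS fi|exact: integrableS ki].
rewrite -fE// -kE// !stieltjes_measure_co//= -!EFinD; congr (_%:E); ring.
Qed.

Lemma charge_derivative (u w : R -> R) (nu : {charge set mR -> \bar R}) :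
  mug.-integrable (`[a, b[%classic : set mR) (EFin \o w) ->
  (forall t : R, (a <= t)%R -> (t <= b)%R ->
    (u t)%:E = (u a)%:E + \int[mug]_(x in `[a, t[) (w x)%:E) ->
  (forall s t : R, (a <= s)%R -> (s <= t)%R -> (t <= b)%R ->
    nu `[s, t[%classic = (u t - u s)%:E) ->
  forall A : set mR, measurable A -> A `<=` `[a, b[%classic ->
    nu A = \int[mug]_(x in A) (w x)%:E.
Proof.
move=> iw uw nuu.
have mab : measurable (`[a, b[%classic : set mR) by exact: measurable_itv.
(* [w] is integrable on [[a, b[] only; extended by [0] it induces a charge on the whole line. *)
have iwab : mug.-integrable [set: mR] ((EFin \o w) \_ `[a, b[).
  by apply/(integrable_mkcond _ _).1.
pose n2 : {charge set mR -> \bar R} := induced_charge iwab.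
have E (A : set mR) : A `<=` `[a, b[%classic ->
    n2 A = \int[mug]_(x in A) (w x)%:E.
  by move=> Aab; apply: eq_integral => x /[1!inE] /Aab xab; rewrite patchE mem_set.
have mco (s t : R) : measurable (`[s, t[%classic : set mR).
  exact: measurable_itv.
have sub (s t : R) : (a <= s)%R -> (t <= b)%R ->
    (`[s, t[%classic : set mR) `<=` `[a, b[%classic.
  move=> as_ tb x/=; rewrite !in_itv/= => /andP[sx xt].
  by rewrite (le_trans as_ sx) (lt_le_trans xt tb).
have v0 (t : R) : (a <= t)%R -> (t <= b)%R ->
    n2 `[a, t[%classic = (u t - u a)%:E.
  move=> at_ tb; rewrite E; last exact: sub.
  by rewrite EFinB uw// addeC addeA -EFinN -EFinD addNr add0e.
move=> A mA Aab; rewrite -E//; apply: charge_eq_co Aab => // s t as_ st tb.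
rewrite nuu//; have := v0 t (le_trans as_ st) tb.
(* The formula for [u] gives the values on intervals starting at [a]; additivity gives those on [[s,
   t[]. *)
rewrite (_ : `[a, t[%classic = `[a, s[%classic `|` `[s, t[%classic); last first.
  by rewrite -itv_bndbnd_setU// bnd_simp.
rewrite chargeU; [|exact: mco|exact: mco|]; last first.
  rewrite -subset0 => x/= []; rewrite !in_itv/= => /andP[_ xs] /andP[sx _].
  by move: (lt_le_trans xs sx); rewrite ltxx.
rewrite v0 ?(le_trans st)//.
have : n2 `[s, t[%classic \is a fin_num.
  exact: fin_num_measure.
move=> /fineK <-; rewrite -EFinD => -[e]; congr (_%:E); lra.
Qed.

End scalar_derivative.

(** * Distributional derivative *)

Lemma bounded_integrable d (T : measurableType d) (R : realType)
    (mu : {measure set T -> \bar R}) (D : set T) (f : T -> R) (M : R) :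
  measurable D -> (mu D < +oo)%E -> measurable_fun D f ->
  (forall x, D x -> `|f x| <= M) -> mu.-integrable D (EFin \o f).
Proof.
move=> mD muD mf fM; apply: measurable_bounded_integrable => //.
exists M; split; first exact: num_real.
by move=> r Mr x Dx; exact: le_trans (fM _ Dx) (ltW Mr).
Qed.

Lemma continuous_itv_bounded (R : realType) (a b : R) (f : R -> R) :
  continuous f -> exists M, forall x, a <= x <= b -> `|f x| <= M.
Proof.
move=> cf; have [ab|ba] := leP a b; last first.
  exists 0 => x /andP[ax xb].
  by have := le_lt_trans (le_trans ax xb) ba; rewrite ltxx.
have cnf : continuous (Num.norm \o f).
  by move=> x; apply: continuous_comp; [exact: cf|exact: norm_continuous].
have [c _ fc] := EVT_max ab (continuous_subspaceT cnf).
by exists `|f c| => x xab; apply: fc; rewrite in_itv.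
Qed.

Section by_parts.
Context (R : realType) (a b : R) (h : derivator a b) (phi : R -> R).
Hypothesis ab : a < b.
Hypothesis dphi : forall x, derivable phi x 1.
Hypothesis cphi' : continuous (derive1 phi).
Hypotheses (phia : phi a = 0) (phib : phi b = 0).
Local Notation mR := (measurableTypeR R).
Local Notation leb := (@lebesgue_measure R).
Local Notation mh := (stieltjes_measure h).
Local Notation D := (`[a, b[%classic : set mR).
Local Open Scope ereal_scope.

Let mD : measurable D. Proof. exact: measurable_itv. Qed.

Let cphi : continuous phi.
Proof. by move=> x; exact/differentiable_continuous/derivable1_diffP. Qed.

Let mphi' : measurable_fun [set: mR] (derive1 phi).
Proof. exact: continuous_measurable_fun. Qed.

Let lebD : leb D < +oo.
Proof. by rewrite /= lebesgue_measure_itv/= lte_fin ab -EFinD ltry. Qed.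

Let FTC x : (a <= x)%R -> (x < b)%R ->
  \int[leb]_(t in `]x, b[) (derive1 phi t)%:E = (- phi x)%:E.
Proof.
move=> ax xb; rewrite -(@integral_itv_bndoo _ _ _ _ true false); last first.
  exact/measurable_EFinP/measurable_funTS.
rewrite (continuous_FTC2 (F := phi) xb).
- by rewrite phib sub0e.
- exact: continuous_subspaceT.
- split; first by move=> *; exact: dphi.
  + by apply: cvg_at_right_filter; exact: cphi.
  + by apply: cvg_at_left_filter; exact: cphi.
- by move=> y _.
Qed.

(** For Fubini, Lebesgue measure is replaced by its finite restriction to [D], for which a bounded
    measurable kernel is integrable; this converts back. *)
Let restricted_integral (mu : {measure set mR -> \bar R})
    (muD : mu D < +oo) (f : mR -> \bar R) :
  (forall x, ~ D x -> f x = 0) ->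
  \int[mfrestr mD muD]_x f x = \int[mu]_(x in D) f x.
Proof.
move=> f0; rewrite (_ : f = f \_ D); last first.
  by apply/funext => x; rewrite patchE; case: ifPn => // /negP; rewrite inE => /f0.
rewrite -integral_mkcond -[in RHS]integral_mkcondr setIid.
by apply: eq_measure_integral => A mA AD; rewrite /= /mfrestr /mrestr setIidl.
Qed.

(** The kernel [phi'(t) 1_{x < t}] for [x] and [t] in [D]. Integrated in [t] it gives [- phi x];
    integrated in [x] against [mh] it gives [phi'(t) (h t - h a)]. *)
Let q (z : mR * mR) : R :=
  (\1_D z.1 * (\1_D z.2 * derive1 phi z.2) *
    \1_[set z : mR * mR | (z.1 < z.2)%R] z)%R.

Let mq : measurable_fun [set: mR * mR] q.
Proof.
have mlt : measurable [set z : mR * mR | (z.1 < z.2)%R].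
  have := @measurable_fun_ltr _ (mR * mR)%type R setT fst snd
    measurable_fst measurable_snd.
  by move=> /(_ measurableT [set true] I); rewrite setTI.
apply: measurable_funM; last exact: measurable_indic.
apply: measurable_funM.
  by apply: measurableT_comp => //; exact: measurable_indic.
apply: measurable_funM.
  by apply: measurableT_comp => //; exact: measurable_indic.
exact: measurableT_comp.
Qed.

Let mh_fun : measurable_fun D h.
Proof.
apply: (@eq_measurable_fun _ _ _ _ _ (h \o clamp a b)).
  move=> x; rewrite inE/= in_itv/= => /andP[ax xb]; congr (h _).
  by rewrite /clamp (min_idPr (ltW xb)) (max_idPr ax).
apply: measurable_funTS; apply: nondecreasing_measurable => //= x y xy.
apply: derivator_nondecreasing; rewrite ?in_itv/= ?clamp_ge ?clamp_le ?(ltW ab)//.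
exact: clamp_homo.
Qed.

Let h_bounded x : D x -> (`|h x| <= `|h a| + `|h b|)%R.
Proof.
rewrite /= in_itv/= => /andP[ax xb].
have hax : (h a <= h x)%R.
  by apply: derivator_nondecreasing; rewrite ?in_itv/= ?lexx ?ax ?ltW.
have hxb : (h x <= h b)%R.
  by apply: derivator_nondecreasing; rewrite ?in_itv/= ?lexx ?ax ?ltW.
have := ler_norm (h b); have := ler_norm (- h a); rewrite normrN.
have := normr_ge0 (h b); have := normr_ge0 (h a).
by rewrite ler_norml => *; apply/andP; split; lra.
Qed.

(** Fubini for the kernel [q]. The constant [h a] drops out because [phi] vanishes at both ends, so
    that [phi'] has integral zero. *)
Lemma stieltjes_by_parts :
  leb.-integrable D (fun t => (h t * derive1 phi t)%:E) /\
  \int[leb]_(t in D) (h t * derive1 phi t)%:E = - \int[mh]_(x in D) (phi x)%:E.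
Proof.
have [M phiM] := continuous_itv_bounded a b cphi'.
have lebT : mfrestr mD lebD [set: mR] < +oo.
  by rewrite /mfrestr/= /mrestr setTI.
have qM z : (`|q z| <= `|M|)%R.
  rewrite /q !indicE; case: (z.1 \in D); rewrite ?mul0r ?normr0// mul1r.
  have [Dz|] := boolP (z.2 \in D); last by rewrite !mul0r normr0.
  case: (z \in _); last by rewrite mulr0 normr0.
  rewrite mul1r mulr1 (le_trans _ (ler_norm _))//; apply: phiM.
  by move: Dz; rewrite inE/= in_itv/= => /andP[-> /ltW].
have iq : (mh \x mfrestr mD lebD).-integrable [set: mR * mR] (EFin \o q).
  apply: (@bounded_integrable _ _ _ _ _ _ `|M|%R) => //.
  have := product_measure1E mh (mfrestr mD lebD) measurableT measurableT.
  rewrite setXTT => /= ->; rewrite lte_mul_pinfty//.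
  by rewrite fin_num_measure.
have inner1 x : \int[mfrestr mD lebD]_y (q (x, y))%:E =
    ((fun x => (- phi x)%:E) \_ D) x.
  rewrite patchE; case: ifPn => [Dx|nDx]; last first.
    by rewrite integral0_eq// => y _; rewrite /q indicE (negbTE nDx) !mul0r.
  rewrite restricted_integral; last first.
    move=> y nDy; rewrite /q/= [X in (_ * (X * _))%R]indicE memNset//.
    by rewrite mul0r mulr0 mul0r.
  have := Dx; rewrite inE/= in_itv/= => /andP[ax xb].
  rewrite -FTC// -[X in \int[_]_(t in X) _ = _]/D.
  have -> : `]x, b[%classic = D `&` `]x, b[%classic.
    apply/esym/setIidPr => t /=; rewrite !in_itv/= => /andP[xt ->].
    by rewrite (le_trans ax)// ltW.
  rewrite integral_mkcondr; apply: eq_integral => t Dt.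
  rewrite /q patchE/= !indicE Dx Dt !mul1r.
  have tb : (t < b)%R by move: Dt; rewrite inE/= in_itv/= => /andP[].
  have -> : (t \in `]x, b[%classic) = ((x, t) \in [set z : mR * mR | (z.1 < z.2)%R]).
    by apply/idP/idP; rewrite !inE/= in_itv/= ?tb ?andbT.
  by case: ifPn; rewrite ?mulr1 ?mulr0.
have inner2 y : D y -> \int[mh]_x (q (x, y))%:E =
    (derive1 phi y * (h y - h a))%:E.
  move=> Dy; have := Dy; rewrite /= in_itv/= => /andP[ay yb].
  transitivity (\int[mh]_(x in `[a, y[) cst (derive1 phi y)%:E x).
    rewrite [RHS]integral_mkcond; apply: eq_integral => x _.
    rewrite /q patchE/= !indicE (mem_set Dy) mul1r.
    have -> : (x \in `[a, y[%classic) =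
        (x \in D) && ((x, y) \in [set z : mR * mR | (z.1 < z.2)%R]).
      apply/idP/andP; rewrite !inE/= !in_itv/= => -[].
        by move=> /andP[-> xy]; rewrite xy (lt_trans xy).
      by move=> /andP[-> _] ->.
    by case: (x \in D); case: (_ \in _); rewrite ?mul1r ?mul0r ?mulr1 ?mulr0.
  rewrite integral_cst; last exact: measurable_itv.
  by rewrite EFinM -stieltjes_measure_co// ltW.
have mphiD : mh.-integrable D (EFin \o phi).
  have [N phiN] := continuous_itv_bounded a b cphi.
  apply: (@bounded_integrable _ _ _ _ _ _ N) => //.
  - by rewrite ltey_eq fin_num_measure.
  - by apply: measurable_funTS; exact: continuous_measurable_fun.
  - by move=> x /=; rewrite in_itv/= => /andP[ax xb]; rewrite phiN// ax ltW.
have hphi : leb.-integrable D (fun t => (h t * derive1 phi t)%:E).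
  apply: (@bounded_integrable _ _ _ _ _ _ ((`|h a| + `|h b|) * M)%R) => //.
  - by apply: measurable_funM => //; exact: measurable_funTS.
  - move=> x Dx; rewrite normrM ler_pM ?h_bounded// phiM//.
    by move: Dx; rewrite /= in_itv/= => /andP[-> /ltW].
have iphi' : leb.-integrable D (EFin \o derive1 phi).
  apply: (@bounded_integrable _ _ _ _ _ _ M) => //.
    exact: measurable_funTS.
  by move=> x; rewrite /= in_itv/= => /andP[ax /ltW xb]; rewrite phiM// ax.
split=> //.
have := Fubini iq; rewrite /=.
under eq_integral do rewrite inner1.
rewrite -integral_mkcond.
rewrite restricted_integral; last first.
  move=> y nDy; rewrite integral0_eq// => x _.
  by rewrite /q/= [X in (_ * (X * _))%R]indicE memNset// mul0r mulr0 mul0r.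
have -> : \int[leb]_(y in D) \int[mh]_x (q (x, y))%:E =
    \int[leb]_(y in D) ((derive1 phi y * h y)%:E - (derive1 phi y * h a)%:E).
  by apply: eq_integral => y; rewrite inE => /inner2 ->; rewrite mulrBr EFinB.
rewrite integralB//=; last 2 first.
- by apply: eq_integrable hphi => // x _; rewrite mulrC.
- by apply: eq_integrable (integrableZr mD (h a) iphi') => // x _; rewrite /= EFinM.
have -> : \int[leb]_(x in D) (derive1 phi x * h a)%:E =
    \int[leb]_(x in D) (derive1 phi x)%:E * (h a)%:E.
  by rewrite -integralZr//; apply: eq_integral => x _; rewrite EFinM.
have -> : \int[leb]_(x in D) (derive1 phi x)%:E = 0.
  rewrite integral_itv_bndoo ?FTC ?phia ?oppr0//.
  exact/measurable_EFinP/measurable_funTS.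
rewrite mul0e sube0.
under eq_integral do rewrite EFinN.
rewrite integralN; last exact: integrable_add_def.
by move=> ->; apply: eq_integral => x _; rewrite mulrC.
Qed.
End by_parts.

Section distributional.
Context (R : realType) (a b : R).
Local Notation mR := (measurableTypeR R).
Local Notation leb := (@lebesgue_measure R).
Local Notation D := (`[a, b[%classic : set mR).
Local Notation E := (`]a, b[%classic : set mR).
Local Open Scope ereal_scope.

Let mE : measurable E. Proof. exact: measurable_itv. Qed.

Let ED : E `<=` D. Proof. exact: subset_itv_oo_co. Qed.

(** On [E] both pairs represent [nu], so [jordan_pos H + m2] and [m1 + jordan_neg H] agree there as
    measures, and [phi] is integrated against both. Any Hahn decomposition is allowed, in particular
    the one chosen in [charge_integral]. *)
Lemma jordan_integral (nu : {charge set mR -> \bar R}) (P N : set mR)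
    (H : hahn_decomposition nu P N)
    (m1 m2 : {finite_measure set mR -> \bar R}) (phi : mR -> R) (M : R) :
  (forall A : set mR, measurable A -> A `<=` E -> nu A = m1 A - m2 A) ->
  measurable_fun E phi -> (forall x, E x -> (`|phi x| <= M)%R) ->
  \int[jordan_pos H]_(x in E) (phi x)%:E - \int[jordan_neg H]_(x in E) (phi x)%:E =
  \int[m1]_(x in E) (phi x)%:E - \int[m2]_(x in E) (phi x)%:E.
Proof.
move=> nuE mphi phiM.
have iphi (m : {finite_measure set mR -> \bar R}) : m.-integrable E (EFin \o phi).
  by apply: (bounded_integrable _ _ mphi phiM) => //; rewrite ltey_eq fin_num_measure.
have fphi (m : {finite_measure set mR -> \bar R}) :
    \int[m]_(x in E) (phi x)%:E \is a fin_num.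
  by apply: integrable_fin_num => //; exact: iphi.
apply/sube_eq_cross; [exact: fphi..|].
rewrite -(integral_measure_add mE (iphi (jordan_pos H)) (iphi m2)).
rewrite -(integral_measure_add mE (iphi m1) (iphi (jordan_neg H))).
apply: eq_measure_integral => A mA AE; rewrite [LHS]measure_addE [RHS]measure_addE.
apply/(sube_eq_cross (fin_num_measure (jordan_pos H) _ mA)
  (fin_num_measure (jordan_neg H) _ mA) (fin_num_measure m1 _ mA)
  (fin_num_measure m2 _ mA)).1.
rewrite -nuE//; have := jordan_decomp H mA; rewrite /cadd/= cscaleN1/=.
by move=> ->.
Qed.

Variables (g : derivator a b) (u : R -> R).
Hypotheses (ab : (a < b)%R) (gu : gAC a b g u).

Lemma gAC_distributional (nu : {charge set mR -> \bar R}) (phi : R -> R) :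
  (forall s t : R, (a <= s)%R -> (s <= t)%R -> (t <= b)%R ->
    nu `[s, t[%classic = (u t - u s)%:E) ->
  test_function a b phi ->
  \int[leb]_(x in E) (u x * derive1 phi x)%:E =
  - charge_integral nu E (EFin \o phi).
Proof.
move=> nuu [dphi [c [e [ac eb phi0]]]].
have phia : phi a = 0%R by apply: phi0; rewrite in_itv/= leNgt ac.
have phib : phi b = 0%R by apply: phi0; rewrite in_itv/= [(b <= e)%R]leNgt eb andbF.
have dphi0 x : derivable phi x 1 := dphi 0%N x.
have cphi' : continuous (derive1 phi).
  by move=> x; apply/differentiable_continuous/derivable1_diffP; exact: (dphi 1%N).
have cphi : continuous phi.
  by move=> x; exact/differentiable_continuous/derivable1_diffP.
pose V := gac_pos ab gu; pose W := gac_neg ab gu.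
have [iV eV] := stieltjes_by_parts V ab dphi0 cphi' phia phib.
have [iW eW] := stieltjes_by_parts W ab dphi0 cphi' phia phib.
(* [phi] vanishes at [a], so an atom that a Stieltjes measure may have there does not contribute. *)
have DE (m : {measure set mR -> \bar R}) :
    \int[m]_(x in D) (phi x)%:E = \int[m]_(x in E) (phi x)%:E.
  rewrite integral_mkcond [RHS]integral_mkcond; congr (integral _ _ _).
  apply/funext => x; rewrite !patchE.
  case: ifPn => xD; case: ifPn => xE //.
    have -> : x = a; last by rewrite phia.
    move: xD xE; rewrite inE notin_setE /= !in_itv/= => /andP[ax xb].
    rewrite xb andbT => /negP; rewrite -leNgt => xa.
    by apply/le_anti; rewrite ax xa.
  by move: xE xD; rewrite inE => /ED xD; rewrite mem_set.
have uE x : (u x * derive1 phi x)%:E =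
    (V x * derive1 phi x)%:E - (W x * derive1 phi x)%:E.
  by rewrite -EFinB -mulrBl -gac_pos_negE.
have mD : measurable D by exact: measurable_itv.
transitivity (\int[leb]_(x in D) (u x * derive1 phi x)%:E).
  apply/esym; apply: integral_itv_bndoo.
  have : leb.-integrable D (fun x => (u x * derive1 phi x)%:E).
    by apply: eq_integrable (integrableB mD iV iW) => // x _; rewrite uE.
  by move=> /measurable_int; apply: measurable_funS.
under eq_integral do rewrite uE.
rewrite integralB// eV eW !DE.
have [M phiM] := continuous_itv_bounded a b cphi.
have -> : charge_integral nu E (EFin \o phi) =
    \int[stieltjes_measure V]_(x in E) (phi x)%:E -
    \int[stieltjes_measure W]_(x in E) (phi x)%:E.
  rewrite /charge_integral/=; apply: (@jordan_integral _ _ _ _ _ _ _ M).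
  (* [nu] and the difference of the measures of [V] and [W] take the same values on intervals, hence
     on all Borel subsets of [[a, b[]. *)
  - move=> A mA AE; have AD := subset_trans AE ED.
    pose n2 : {charge set mR -> \bar R} :=
      cadd (charge_of_finite_measure (stieltjes_measure V))
           (copp (charge_of_finite_measure (stieltjes_measure W))).
    rewrite (charge_eq_co (n2 := n2) _ mA AD)// => s t as_ st tb.
    rewrite nuu// /n2/= /cadd/= /copp/= !stieltjes_measure_co//=.
    by rewrite -EFinB; congr (_%:E); ring.
  - by apply: measurable_funTS; exact: continuous_measurable_fun.
  - by move=> x; rewrite /= in_itv/= => /andP[ax xb]; rewrite phiM// !ltW.
have fW : \int[stieltjes_measure W]_(x in E) (phi x)%:E \is a fin_num.
  apply: (integrable_fin_num mE); apply: (bounded_integrable (M := M) mE).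
  - by rewrite ltey_eq fin_num_measure.
  - by apply: measurable_funTS; exact: continuous_measurable_fun.
  - by move=> x; rewrite /= in_itv/= => /andP[ax xb]; rewrite phiM// !ltW.
by rewrite oppeK (fin_num_oppeB _ fW).
Qed.
End distributional.

(** * Lebesgue decomposition *)

(** [D] is the union of the sets where [f] is at least [1/(n+1)], each finite because the sum is. *)
Lemma esum_countable (R : realType) (T : choiceType) (D : set T) (f : T -> \bar R) :
  (forall t, D t -> (0 < f t)%E) -> (\esum_(t in D) f t < +oo)%E -> countable D.
Proof.
move=> f0 foo.
have -> : D = \bigcup_n [set t | D t /\ (n.+1%:R^-1%:E <= f t)%E].
  apply/seteqP; split => [t Dt|t [n _ []]//].
  have [M M0 Mf] : exists2 M : R, 0 < M & (M%:E <= f t)%E.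
    have := f0 t Dt; case: (f t) => [r| |] //; last by exists 1; rewrite ?leey.
    by rewrite lte_fin => r0; exists r.
  have [n _ nM] := near_infty_natSinv_lt (PosNum M0).
  by exists n => //; split => //; rewrite (le_trans _ Mf)// lee_fin ltW// nM/=.
apply: bigcup_countable => // n _; apply: finite_set_countable.
apply: contrapT => infD.
have D_ge0 t : D t -> (0 <= f t)%E by move=> /f0/ltW.
have ffin : \esum_(t in D) f t \is a fin_num.
  by rewrite ge0_fin_numE//; exact: esum_ge0.
(* With this [k], already [k] points of value at least [1/(n+1)] would exceed the total sum. *)
pose k := (Num.truncn (fine (\esum_(t in D) f t) * n.+1%:R)).+1.
have [F FD kF] := infinite_set_fset k infD.
have : ((k%:R / n.+1%:R)%:E <= \esum_(t in D) f t)%E.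
  apply: esum_ge; eexists; first by split; [exact: finite_fset F|move=> t /FD[]].
  rewrite fsbig_finite//= set_fsetK.
  apply: (@le_trans _ _ (\sum_(t <- finmap.enum_fset F) n.+1%:R^-1%:E)%E).
    rewrite sumEFin lee_fin big_const_seq count_predT iter_addr_0.
    by rewrite -[leRHS]mulr_natl ler_wpM2r ?invr_ge0// ler_nat.
  rewrite big_seq [leRHS]big_seq; apply: lee_sum => t tF.
  by have [] := FD t tF.
rewrite -(fineK ffin) lee_fin leNgt => /negP; apply.
by rewrite ltr_pdivlMr// truncnS_gt.
Qed.

(** The cells are the fibres of an injection into [nat]; empty cells are allowed so that finite and
    infinite sets alike become sequences, the form countable additivity takes. *)
Lemma countable_partition (T : Type) (A : set T) : countable A ->
  exists F : nat -> set T, [/\ trivIset [set: nat] F, A = \bigcup_n F n &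
    forall n, F n = set0 \/ exists2 t, A t & F n = [set t]].
Proof.
move=> /countable_injP[f fI]; exists (fun n => [set t | A t /\ f t = n]); split.
- by apply/trivIsetP => i j _ _ ij; rewrite -subset0 => t/= [[_ fi] [_ fj]];
    move: ij; rewrite -fi -fj eqxx.
- by apply/seteqP; split => [t At|t [n _ []//]]; exists (f t).
- move=> n; have [[t [At ft]]|nt] := pselect (exists t, A t /\ f t = n); last first.
    by left; rewrite -subset0 => t Ft; apply: nt; exists t.
  right; exists t => //; apply/seteqP; split => [s/= [As fs]|s/= ->//].
  by apply: fI; [exact: mem_set|exact: mem_set|rewrite fs].
Qed.

Section decomposition.
Context (R : realType) (a b : R) (g : derivator a b) (rho : R -> R).
Context (musc : {finite_measure set (measurableTypeR R) -> \bar R}).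
Hypothesis LD : lebesgue_decomposition g rho musc.
Local Notation mR := (measurableTypeR R).
Local Notation cR := (caratheodory_type (mu_ext (@wlength R idfun))).
Local Notation lebc := (@completed_lebesgue_measure R).
Local Notation mug := (stieltjes_measure g).
Local Notation D := (`[a, b[%classic : set mR).
Local Notation J := (jumps g).
Local Open Scope ereal_scope.

Let mcara (A : set mR) : measurable A -> measurable (A : set cR).
Proof. exact: sub_caratheodory. Qed.

Let mD : measurable D. Proof. exact: measurable_itv. Qed.

Let mid : measurable_fun [set: cR] (id : cR -> mR).
Proof. by move=> _ A mA; rewrite setTI; exact: mcara. Qed.

Let mrho : measurable_fun (D : set cR) rho.
Proof. exact/measurable_EFinP/(measurable_int _ (density_integrable LD)). Qed.

Let mfun (w : mR -> R) : measurable_fun [set: mR] w ->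
  measurable_fun [set: cR] (w : cR -> R).
Proof. by move=> mw; exact: (measurableT_comp mw mid). Qed.

(** [rho] is nonnegative only almost everywhere; its norm is a density nonnegative everywhere, as
    [ge0_integral_density] asks. *)
Lemma rho_norm_ae (C : set cR) : C `<=` D ->
  ae_eq lebc C (fun x => (rho x)%:E) (fun x => `|rho x|%:E).
Proof.
move=> CD.
have := density_ge0 LD; apply: negligibleS => x /=; apply: contra_not => rho0.
by move/CD; rewrite /= in_itv/= => /andP[ax xb]; rewrite ger0_norm// rho0.
Qed.

Let mrhon : measurable_fun (D : set cR) (Num.norm \o rho).
Proof. exact: measurableT_comp. Qed.

Let integral_rho (C : set mR) : measurable C -> C `<=` D ->
  \int[lebc]_(x in C) (rho x)%:E = \int[lebc]_(x in C) `|rho x|%:E.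
Proof.
move=> mC CD; apply: ae_eq_integral.
- exact: mcara.
- by apply/measurable_EFinP; exact: (measurable_funS (mcara mD) CD mrho).
- by apply/measurable_EFinP; exact: (measurable_funS (mcara mD) CD mrhon).
- exact: rho_norm_ae.
Qed.

Lemma stieltjes_decomposition (C : set mR) : measurable C -> C `<=` D ->
  mug C = \int[lebc]_(x in C) `|rho x|%:E + musc C +
    \esum_(t in J `&` C) (jump g t)%:E.
Proof.
move=> mC CD; rewrite (decompositionE LD mC CD) integral_rho//; congr (_ + _).
rewrite esum_mkcondr; apply: eq_esum => t _; rewrite diracE.
by case: (t \in C); rewrite ?mule1 ?mule0.
Qed.

Lemma jumps_sub : J `<=` D.
Proof. by move=> t [at_ tb _]; rewrite /= in_itv/= at_. Qed.

Let jump_ge0 t : J t -> 0 <= (jump g t)%:E.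
Proof. by move=> [_ _ t0]; rewrite lee_fin ltW. Qed.

(** The jumps are positive, and their sum is one of three nonnegative terms that make up the finite
    mass of [[a, b[]. *)
Lemma jumps_countable : countable J.
Proof.
apply: (@esum_countable _ _ _ (EFin \o jump g)).
  by move=> t [_ _ t0]; rewrite lte_fin.
have := stieltjes_decomposition mD (@subset_refl _ _); rewrite (setIidl jumps_sub) => e.
apply: (@le_lt_trans _ _ (mug D)); last by rewrite ltey_eq fin_num_measure.
by rewrite e leeDr// adde_ge0// integral_ge0.
Qed.

Lemma jumps_measurable : measurable (J : set mR).
Proof.
have [F [_ -> F1]] := countable_partition jumps_countable.
by apply: bigcupT_measurable => n; have [->|[t _ ->]] := F1 n.
Qed.

Let lebc_jumps0 : lebc J = 0.
Proof. exact: (countable_lebesgue_measure0 jumps_countable). Qed.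

Lemma musc_jumps0 : musc J = 0.
Proof.
have [F [tF JF F1]] := countable_partition jumps_countable.
rewrite {1}JF; apply/negligibleP.
  by rewrite -JF; exact: jumps_measurable.
apply: negligible_bigcup => n; have [->|[t Jt ->]] := F1 n.
  exact: negligible_set0.
apply/negligibleP => //; have [at_ tb _] := Jt.
exact: sc_continuous LD _ at_ tb.
Qed.

(** At a singleton the absolutely continuous and singular continuous parts vanish. *)
Lemma stieltjes_jump t : J t -> mug [set t] = (jump g t)%:E.
Proof.
move=> Jt; rewrite stieltjes_decomposition//; last by move=> _ ->; exact: jumps_sub.
have [at_ tb _] := Jt; rewrite (sc_continuous LD at_ tb) adde0.
rewrite setI1 mem_set// esum_set1 ?jump_ge0//.
rewrite null_set_integral ?add0e//.
- exact: mcara.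
- apply/measurable_EFinP; apply: (measurable_funS (mcara mD) _ mrhon).
  by move=> _ ->; exact: jumps_sub.
- exact: lebesgue_measure_set1.
Qed.

Lemma ge0_integral_jumps (A : set mR) (w : mR -> R) : measurable A ->
  measurable_fun [set: mR] w -> (forall x, (0 <= w x)%R) ->
  \int[mug]_(x in J `&` A) (w x)%:E = \esum_(t in J `&` A) (jump g t * w t)%:E.
Proof.
move=> mA mw w0.
have [F [tF JF F1]] := countable_partition
  (sub_countable (subset_card_le (@subIsetl _ J A)) jumps_countable).
have w0' t : (J `&` A) t -> 0 <= (jump g t * w t)%:E.
  by move=> [Jt _]; rewrite EFinM; apply: mule_ge0; [exact: jump_ge0|rewrite lee_fin].
have mF n : measurable (F n) by have [->|[t _ ->]] := F1 n.
rewrite JF ge0_integral_bigcup//; last 2 first.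
- by apply/measurable_EFinP; exact: measurable_funTS.
- by move=> x _; rewrite lee_fin.
rewrite esum_bigcup; last 2 first.
- by move=> i j _ _; exact: tF.
- by rewrite -JF.
rewrite nneseries_esumT; last first.
  by move=> n; apply: integral_ge0 => x _; rewrite lee_fin.
apply: eq_esum => n _; have [->|[t JAt ->]] := F1 n.
  by rewrite integral_set0 esum_set0.
rewrite esum_set1 ?w0'//.
transitivity (\int[mug]_(x in [set t]) cst (w t)%:E x).
  by apply: eq_integral => x /set_mem ->.
by rewrite integral_cst//= EFinM muleC -stieltjes_jump//; case: JAt.
Qed.

(** On each of three pieces of [A] only one term of [stieltjes_decomposition] survives, and that
    term does not charge the other two pieces, so its integral extends to all of [A]. *)
Lemma ge0_integral_decomposition (A : set mR) (w : mR -> R) :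
  measurable A -> A `<=` D -> measurable_fun [set: mR] w ->
  (forall x, (0 <= w x)%R) ->
  \int[mug]_(x in A) (w x)%:E =
  \int[lebc]_(x in A) (w x * `|rho x|)%:E + \int[musc]_(x in A) (w x)%:E
  + \esum_(t in J `&` A) (jump g t * w t)%:E.
Proof.
move=> mA AD mw w0; have mJ := jumps_measurable.
have [N [mN N0 muscN]] := sc_singular LD.
have lebcN0 : lebc N = 0 := N0.
have mwE (B : set mR) : measurable_fun B (EFin \o w).
  by apply/measurable_EFinP; exact: measurable_funTS.
have w0E x : 0 <= (w x)%:E by rewrite lee_fin.
have mAJ : measurable (A `\` J) by exact: measurableD.
have esum0 C : C `<=` ~` J -> \esum_(t in J `&` C) (jump g t)%:E = 0.
  by move=> CJ; rewrite (_ : J `&` C = set0) ?esum_set0// -subset0 => t [Jt /CJ].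
have split_int (B S : set mR) : measurable B -> measurable S ->
    \int[mug]_(x in B) (w x)%:E =
    \int[mug]_(x in B `\` S) (w x)%:E + \int[mug]_(x in S `&` B) (w x)%:E.
  move=> mB mS; rewrite addeC -{1}(setUIDK B S) [B `&` S]setIC.
  rewrite (ge0_integral_setU _ (measurableI _ _ mS mB) (measurableD mB mS) (mwE _)
    (fun x _ => w0E x))//.
  by rewrite disj_set2E [S `&` B]setIC setDE setIACA setICr setI0.
rewrite (split_int A J)//.
rewrite ge0_integral_jumps//; congr (_ + _).
rewrite (split_int (A `\` J) N)// [N `&` _]setIC; congr (_ + _).
- have mwr (B : set mR) : measurable B -> B `<=` A ->
      measurable_fun (B : set cR) (fun x => (w x * `|rho x|)%:E).
    move=> mB BA; apply/measurable_EFinP; apply: measurable_funM.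
      by apply: measurable_funTS; exact: mfun.
    exact: (measurable_funS (mcara mD) (subset_trans BA AD) mrhon).
  have wr0 x : 0 <= (w x * `|rho x|)%:E by rewrite lee_fin mulr_ge0.
  (* [J] is countable and [N] is Lebesgue-null, so both can be removed from the domain of the
     Lebesgue integral. *)
  rewrite [RHS](ge0_negligible_integral (mu := lebc) (mcara mJ) (mcara mA)
    (mwr _ mA (@subset_refl _ _)) (fun x _ => wr0 x) lebc_jumps0).
  rewrite [RHS](ge0_negligible_integral (mu := lebc) (mcara mN) (mcara mAJ)
    (mwr _ mAJ (@subDsetl _ _ _)) (fun x _ => wr0 x) lebcN0).
  rewrite (ge0_integral_density (la := lebc) (r := Num.norm \o rho) mid)//.
  + exact: measurableD.
  + apply: (measurable_funS (mcara mD) _ mrhon).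
    by move=> x [[/AD]].
  + by move=> x _; exact: normr_ge0.
  + move=> C mC CB; have CD : C `<=` D by move=> x /CB[[/AD]].
    apply: etrans (stieltjes_decomposition mC CD) _.
    rewrite esum0; last by move=> x /CB[[]].
    rewrite adde0 (_ : musc C = 0) ?adde0//.
    apply/eqP; rewrite eq_le measure_ge0 andbT -muscN.
    apply: le_measure; [exact: mem_set mC|exact/mem_set/measurableD|].
    by move=> x Cx; have [[/AD Dx _] Nx] := CB _ Cx.
- transitivity (\int[musc]_(x in (A `\` J) `&` N) (w x)%:E).
    apply: eq_measure_integral => C mC CB.
    have CD : C `<=` D by move=> x /CB[[/AD]].
    apply: etrans (stieltjes_decomposition mC CD) _.
    rewrite esum0; last by move=> x /CB[[]].
    rewrite null_set_integral ?add0e ?adde0//.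
    + exact: mcara.
    + apply/measurable_EFinP; apply: (measurable_funS (mcara mD) _ mrhon).
      by move=> x /CB[[/AD]].
    + apply: (subset_measure0 (mcara mC) (mcara mN) _ lebcN0).
      by move=> x /CB[].
  rewrite [RHS](ge0_negligible_integral mJ mA (mwE A) (fun x _ => w0E x) musc_jumps0).
  (* [musc] lives on [N]: removing the [musc]-null set [D] minus [N] from the domain leaves only
     points of [N]. *)
  have mDN : measurable (D `\` N) by exact: measurableD.
  rewrite [RHS](ge0_negligible_integral mDN mAJ (mwE _) (fun x _ => w0E x) muscN).
  congr (integral _ _ _); apply/seteqP; split=> x.
    by move=> [[Ax nJx] Nx]; split=> // -[_]; exact.
  move=> [[Ax nJx] nDN]; split => //; apply: contrapT => nNx; apply: nDN.
  by split => //; exact: AD.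
Qed.
End decomposition.

(** * Signed integrands, through a Borel version [w] of [v] *)

Section signed_decomposition.
Context (R : realType) (a b : R) (g : derivator a b) (rho : R -> R).
Context (musc : {finite_measure set (measurableTypeR R) -> \bar R}).
Hypothesis LD : lebesgue_decomposition g rho musc.
Local Notation mR := (measurableTypeR R).
Local Notation cR := (caratheodory_type (mu_ext (@wlength R idfun))).
Local Notation lebc := (@completed_lebesgue_measure R).
Local Notation mug := (stieltjes_measure g).
Local Notation D := (`[a, b[%classic : set mR).
Local Notation J := (jumps g).
Local Open Scope ereal_scope.

Variables (v w : R -> R) (Z : set mR).
Hypotheses (mw : measurable_fun [set: mR] (w : mR -> R)).
Hypotheses (mZ : measurable Z) (Z0 : mug Z = 0).
Hypothesis wv : forall x, D x -> ~ Z x -> w x = v x.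
Hypothesis iw : mug.-integrable D (EFin \o w).

Let mcara (A : set mR) : measurable A -> measurable (A : set cR).
Proof. exact: sub_caratheodory. Qed.

Let mD : measurable D. Proof. exact: measurable_itv. Qed.

Let mfun (f : mR -> R) : measurable_fun [set: mR] f ->
  measurable_fun [set: cR] (f : cR -> R).
Proof. by move=> mf _ B mB; apply: mcara; exact: mf. Qed.

Let mrhon : measurable_fun (D : set cR) (Num.norm \o rho).
Proof.
apply: measurableT_comp => //.
exact/measurable_EFinP/(measurable_int _ (density_integrable LD)).
Qed.

(** All three terms of the decomposition are nonnegative, so each is bounded by the finite integral
    against [mug]; differences of such terms are then meaningful. *)
Let parts_lty (f : mR -> R) (A : set mR) : measurable A -> A `<=` D ->
  measurable_fun [set: mR] f -> (forall x, (0 <= f x)%R) ->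
  mug.-integrable D (EFin \o f) ->
  [/\ \int[mug]_(x in A) (f x)%:E < +oo,
      \int[lebc]_(x in A) (f x * `|rho x|)%:E < +oo,
      \int[musc]_(x in A) (f x)%:E < +oo &
      \esum_(t in J `&` A) (jump g t * f t)%:E < +oo].
Proof.
move=> mA AD mf f0 /integrableP[_ fi].
have fA : \int[mug]_(x in A) (f x)%:E < +oo.
  apply: le_lt_trans fi; under [leRHS]eq_integral do rewrite /= ger0_norm//.
  apply: ge0_subset_integral => //.
  - by apply/measurable_EFinP; exact: measurable_funTS.
  - by move=> x _; rewrite lee_fin.
have i1 : 0 <= \int[lebc]_(x in A) (f x * `|rho x|)%:E.
  by apply: integral_ge0 => x _; rewrite lee_fin mulr_ge0.
have i2 : 0 <= \int[musc]_(x in A) (f x)%:E.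
  by apply: integral_ge0 => x _; rewrite lee_fin.
have i3 : 0 <= \esum_(t in J `&` A) (jump g t * f t)%:E.
  by apply: esum_ge0 => t [[_ _ t0] _]; rewrite lee_fin mulr_ge0// ltW.
have e := ge0_integral_decomposition LD mA AD mf f0.
split=> //; apply: le_lt_trans fA; rewrite e.
- by rewrite -addeA leeDl// adde_ge0.
- by rewrite -addeA addeCA leeDl// adde_ge0.
- by rewrite leeDr// adde_ge0.
Qed.

(** [musc] is at most [mug] on [D]. Hence [w] is a Borel version of [v] for [musc] as well. *)
Let musc_version0 : musc (Z `&` D) = 0.
Proof.
have mZD : measurable (Z `&` D) by exact: measurableI.
have : mug (Z `&` D) = 0 by apply: subset_measure0 Z0 => //; exact: subIsetl.
rewrite (stieltjes_decomposition LD mZD (@subIsetr _ _ _)) => e.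
apply/eqP; rewrite eq_le measure_ge0 andbT -e -addeA addeCA leeDl// adde_ge0//.
  exact: integral_ge0.
by apply: esum_ge0 => t [[_ _ t0] _]; rewrite lee_fin ltW.
Qed.

(** A jump point has positive mass, so it cannot lie in the null set [Z]. *)
Let jumps_version t : J t -> w t = v t.
Proof.
move=> Jt; apply: wv; first exact: (jumps_sub Jt).
move=> Zt; have := stieltjes_jump LD Jt.
have -> : mug [set t] = 0.
  by apply: (subset_measure0 _ mZ _ Z0) => // _ ->.
by case: Jt => _ _ t0 [e]; move: t0; rewrite -e ltxx.
Qed.

(** Outside [Z] the functions [v] and [w] agree. Over the part of [Z] in [D] the integral of [|rho|]
    is at most the mass of that part for [mug], which is zero, so [rho] vanishes there almost
    everywhere. *)
Let ae_version (A : set mR) : A `<=` D ->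
  ae_eq lebc (A : set cR) (fun x => (w x * `|rho x|)%:E) (fun x => (v x * rho x)%:E).
Proof.
move=> AD.
have mZD : measurable (Z `&` D) by exact: measurableI.
have rho0 : ae_eq lebc (Z `&` D : set cR) (fun x => `|rho x|%:E) (cst 0).
  have mrhoZ : measurable_fun (Z `&` D : set cR) (fun x => `|rho x|%:E).
    apply/measurable_EFinP.
    exact: (measurable_funS (mcara mD) (@subIsetr _ _ _) mrhon).
  apply/(ae_eq_integral_abs _ (mcara mZD) mrhoZ).
  have : mug (Z `&` D) = 0 by apply: subset_measure0 Z0 => //; exact: subIsetl.
  rewrite (stieltjes_decomposition LD mZD (@subIsetr _ _ _)) => e.
  under eq_integral do rewrite abse_EFin normr_id.
  apply/eqP; rewrite eq_le integral_ge0 ?andbT// -e -addeA leeDl// adde_ge0//.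
  by apply: esum_ge0 => t [[_ _ t0] _]; rewrite lee_fin ltW.
have := negligibleU rho0 (rho_norm_ae LD (@subset_refl _ _)).
apply: negligibleS => x /= nE; apply: contrapT => /not_orP[/contrapT xZ /contrapT xD].
apply: nE => Ax; have Dx := AD _ Ax; have [rr] := xD Dx.
have [Zx|nZx] := pselect (Z x); last by rewrite -wv// -rr.
have [r0] := xZ (conj Zx Dx); have rx0 : rho x = 0%R := etrans rr r0.
by rewrite rx0 normr0 !mulr0.
Qed.

Let wp (x : mR) : R := Num.max (w x) 0%R.
Let wn (x : mR) : R := Num.max (- w x)%R 0%R.

Let wpn x : w x = (wp x - wn x)%R.
Proof.
rewrite /wp /wn; case: (leP (w x) 0%R) => ?;
  case: (leP (- w x)%R 0%R) => ?; lra.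
Qed.

Let mwp : measurable_fun [set: mR] wp.
Proof. exact: measurable_maxr. Qed.

Let mwn : measurable_fun [set: mR] wn.
Proof. by apply: measurable_maxr => //; exact: measurableT_comp. Qed.

Let wp0 x : (0 <= wp x)%R. Proof. by rewrite /wp le_max lexx orbT. Qed.
Let wn0 x : (0 <= wn x)%R. Proof. by rewrite /wn le_max lexx orbT. Qed.

Let wpE : (EFin \o w)^\+ = EFin \o wp.
Proof. by apply/funext => x; rewrite funeposE/= /wp EFin_max. Qed.

Let wnE : (EFin \o w)^\- = EFin \o wn.
Proof. by apply/funext => x; rewrite funenegE/= /wn EFin_max. Qed.

Let iwp : mug.-integrable D (EFin \o wp).
Proof. by rewrite -wpE; exact: integrable_funepos. Qed.

Let iwn : mug.-integrable D (EFin \o wn).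
Proof. by rewrite -wnE; exact: integrable_funeneg. Qed.

Let mwr (f : mR -> R) (A : set mR) : measurable A -> A `<=` D ->
  measurable_fun [set: mR] f ->
  measurable_fun (A : set cR) (fun x => (f x * `|rho x|)%:E).
Proof.
move=> mA AD mf; apply/measurable_EFinP; apply: measurable_funM.
  by apply: measurable_funTS; exact: mfun.
exact: (measurable_funS (mcara mD) AD mrhon).
Qed.

Let mvr (A : set mR) : measurable A -> A `<=` D ->
  measurable_fun (A : set cR) (fun x => (v x * rho x)%:E).
Proof.
move=> mA AD; apply: (ae_measurable_fun _ (ae_version AD)); last exact: mwr.
exact: completed_lebesgue_measure_is_complete.
Qed.

Let iwabs : mug.-integrable D (EFin \o (Num.norm \o w)).
Proof. exact: integrable_norm. Qed.

Let mwabs : measurable_fun [set: mR] (Num.norm \o w).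
Proof. exact: measurableT_comp. Qed.

Let wabs0 x : (0 <= (Num.norm \o w) x)%R. Proof. exact: normr_ge0. Qed.

Lemma density_part_integrable : lebc.-integrable D (fun x => (v x * rho x)%:E).
Proof.
have [_ fin _ _] := parts_lty mD (@subset_refl _ _) mwabs wabs0 iwabs.
apply/integrableP; split; first exact: mvr.
apply: le_lt_trans fin.
have e : ae_eq lebc (D : set cR) (fun x => `|(w x * `|rho x|)%:E|)
    (fun x => `|(v x * rho x)%:E|).
  exact: ae_eq_abse (ae_version (@subset_refl _ _)).
rewrite -(ge0_ae_eq_integral (mcara mD) _ _ _ _ e).
- rewrite le_eqVlt; apply/orP; left; apply/eqP.
  by apply: eq_integral => x _; rewrite /= normrM normr_id.
- apply: measurableT_comp => //; exact: mwr.
- apply: measurableT_comp => //; exact: mvr.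
- by [].
- by [].
Qed.

Let wv_musc x : D x -> ~ (Z `&` D) x -> w x = v x.
Proof. by move=> Dx nZD; apply: wv => // Zx; apply: nZD. Qed.

Lemma sc_part_integrable : (completion musc).-integrable D (fun x => (v x)%:E).
Proof.
have [_ _ fin _] := parts_lty mD (@subset_refl _ _) mwabs wabs0 iwabs.
apply/(completion_integrableE mD (measurableI _ _ mZ mD) musc_version0 _ wv_musc).
  exact: measurable_funTS.
apply/integrableP; split.
  by apply/measurable_EFinP; exact: measurable_funTS.
exact: fin.
Qed.

Lemma jump_part_summable : summable J (fun t => (jump g t * v t)%:E).
Proof.
have [_ _ _] := parts_lty mD (@subset_refl _ _) mwabs wabs0 iwabs.
rewrite (setIidl (@jumps_sub _ _ _ _)); apply: le_lt_trans.
apply: le_esum => t Jt; rewrite /= lee_fin normrM jumps_version// ger0_norm//.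
by case: Jt => _ _ /ltW.
Qed.

(** Used with [h] equal to [v] and to [- v], for the positive and the negative part in
    [signed_esum]. *)
Let esum_part (f h : R -> R) (A : set mR) :
  (forall t, J t -> (jump g t * f t = Num.max (jump g t * h t) 0)%R) ->
  \esum_(t in J) maxe ((jump g t * h t)%:E * \d_t A) 0 =
  \esum_(t in J `&` A) (jump g t * f t)%:E.
Proof.
move=> fh; rewrite esum_mkcondr; apply: eq_esum => t Jt; rewrite diracE.
by case: (t \in A); rewrite ?mule1 ?mule0 ?maxxx// fh// EFin_max.
Qed.

(** The identity for nonnegative functions is applied to the positive and negative parts of [w] and
    subtracted; finiteness of all six terms permits the regrouping. *)
Lemma integral_decomposition (A : set mR) : measurable A -> A `<=` D ->
  \int[mug]_(x in A) (w x)%:E =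
  \int[lebc]_(x in A) (v x * rho x)%:E +
  \int[completion musc]_(x in A) (v x)%:E +
  signed_esum J (fun t => (jump g t * v t)%:E * \d_t A).
Proof.
move=> mA AD.
have [p1 p2 p3 p4] := parts_lty mA AD mwp wp0 iwp.
have [n1 n2 n3 n4] := parts_lty mA AD mwn wn0 iwn.
have wE : \int[mug]_(x in A) (w x)%:E =
    \int[mug]_(x in A) (wp x)%:E - \int[mug]_(x in A) (wn x)%:E.
  by rewrite integralE -/(EFin \o w) wpE wnE.
have muscE : \int[completion musc]_(x in A) (v x)%:E =
    \int[musc]_(x in A) (wp x)%:E - \int[musc]_(x in A) (wn x)%:E.
  rewrite (completion_integralE mA (measurableI _ _ mZ mD) musc_version0 (w := w)).
  - by rewrite integralE -/(EFin \o w) wpE wnE.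
  - exact: measurable_funTS.
  - by move=> x /AD Dx; exact: wv_musc.
have lebE : \int[lebc]_(x in A) (v x * rho x)%:E =
    \int[lebc]_(x in A) (wp x * `|rho x|)%:E -
    \int[lebc]_(x in A) (wn x * `|rho x|)%:E.
  have ir (f : mR -> R) : measurable_fun [set: mR] f ->
      (forall x, (0 <= f x)%R) ->
      \int[lebc]_(x in A) (f x * `|rho x|)%:E < +oo ->
      lebc.-integrable A (fun x => (f x * `|rho x|)%:E).
    move=> mf f0 fin; apply/integrableP; split; first exact: mwr.
    by under eq_integral do rewrite gee0_abs ?lee_fin ?mulr_ge0//.
  rewrite -(integralB (mcara mA) (ir _ mwp wp0 p2) (ir _ mwn wn0 n2)).
  rewrite -(ae_eq_integral _ _ (mcara mA) (mwr mA AD mw) (mvr mA AD)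
    (ae_version AD)).
  by apply: eq_integral => x _; rewrite wpn mulrBl EFinB.
have jE : signed_esum J (fun t => (jump g t * v t)%:E * \d_t A) =
    \esum_(t in J `&` A) (jump g t * wp t)%:E -
    \esum_(t in J `&` A) (jump g t * wn t)%:E.
  rewrite /signed_esum -(@esum_part wp v) => [|t Jt]; last first.
    by rewrite -jumps_version// maxr_pMr ?mulr0//; case: Jt => _ _ /ltW.
  rewrite -(@esum_part wn (fun t => - v t)%R) => [|t Jt]; last first.
    by rewrite -jumps_version// maxr_pMr ?mulr0//; case: Jt => _ _ /ltW.
  congr (_ - _); apply: eq_esum => t _.
    by rewrite funeposE.
  by rewrite funenegE mulrN EFinN mulNe.
have fin (x : \bar R) : 0 <= x -> x < +oo -> x \is a fin_num.
  by move=> x0 xoo; rewrite ge0_fin_numE.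
rewrite wE muscE lebE jE (ge0_integral_decomposition LD mA AD mwp wp0).
rewrite (ge0_integral_decomposition LD mA AD mwn wn0).
have sub3 (x y z x' y' z' : \bar R) : x \is a fin_num -> y \is a fin_num ->
    z \is a fin_num -> x' \is a fin_num -> y' \is a fin_num ->
    z' \is a fin_num -> x + y + z - (x' + y' + z') = (x - x') + (y - y') + (z - z').
  move=> /fineK <- /fineK <- /fineK <- /fineK <- /fineK <- /fineK <-.
  by rewrite -!EFinD; congr EFin; ring.
have j0 (f : R -> R) : (forall x, (0 <= f x)%R) ->
    0 <= \esum_(t in J `&` A) (jump g t * f t)%:E.
  by move=> f0; apply: esum_ge0 => t [[_ _ t0] _]; rewrite lee_fin mulr_ge0// ltW.
apply: sub3; apply: fin => //; try exact: j0.
- by apply: integral_ge0 => x _; rewrite lee_fin mulr_ge0.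
- by apply: integral_ge0 => x _; rewrite lee_fin.
- by apply: integral_ge0 => x _; rewrite lee_fin mulr_ge0.
- by apply: integral_ge0 => x _; rewrite lee_fin.
Qed.
End signed_decomposition.

(** Integrals of [v] against the completion become integrals of a Borel function [w], which induces
    a charge and can also be integrated against [musc]. *)
Lemma is_gderivative_version (R : realType) (a b : R) (d : nat)
    (g : derivator a b) (U v : R -> 'rV[R]_d) (i : 'I_d) :
  is_gderivative g U v ->
  exists (w : R -> R) (Z : set (measurableTypeR R)),
  [/\ measurable_fun [set: measurableTypeR R] (w : measurableTypeR R -> R),
      [/\ measurable Z, stieltjes_measure g Z = 0%E &
        forall x, `[a, b[%classic x -> ~ Z x -> w x = v x ord0 i],
      (stieltjes_measure g).-integrable
        (`[a, b[%classic : set (measurableTypeR R)) (EFin \o w),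
      forall A : set (measurableTypeR R), measurable A -> A `<=` `[a, b[%classic ->
        (\int[completion (stieltjes_measure g)]_(x in A) (v x ord0 i)%:E =
         \int[stieltjes_measure g]_(x in A) (w x)%:E)%E &
      forall t : R, a <= t -> t <= b -> ((U t ord0 i)%:E = (U a ord0 i)%:E +
        \int[stieltjes_measure g]_(x in `[a, t[) (w x)%:E)%E].
Proof.
move=> [iv Uv].
have mab : measurable (`[a, b[%classic : set (measurableTypeR R)).
  exact: measurable_itv.
have mv : measurable_fun
    (`[a, b[%classic : set (caratheodory_type (mu_ext (stieltjes_measure g))))
    (fun x : R => v x ord0 i).
  exact/measurable_EFinP/(measurable_int _ (iv i)).
have [w [Z [mw mZ Z0 wv]]] := completion_measurable_fun_version mv mab.
have AE (A : set (measurableTypeR R)) : measurable A -> A `<=` `[a, b[%classic ->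
    (\int[completion (stieltjes_measure g)]_(x in A) (v x ord0 i)%:E =
     \int[stieltjes_measure g]_(x in A) (w x)%:E)%E.
  move=> mA Aab; apply: (completion_integralE mA mZ Z0); first exact: measurable_funTS.
  by move=> x /Aab; exact: wv.
exists w, Z; split => //.
- apply/(completion_integrableE mab mZ Z0 (measurable_funTS mw) wv).
  exact: iv.
- move=> t at_ tb; rewrite Uv// AE//.
  by move=> x/=; rewrite !in_itv/= => /andP[-> /lt_le_trans]; exact.
Qed.

Theorem theorem9p1 (R : realType) (a b : R) (d : nat) (g : derivator a b)
    (U : R -> 'rV[R]_d) :
  a < b -> g a < g b -> ACg g U ->
  [/\ BV a b U,
      exists v : R -> 'rV[R]_d, is_gderivative g U v,
      exists DU : 'I_d -> {charge set (measurableTypeR R) -> \bar R},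
        is_derivative_measure a b U DU &
      forall (DU : 'I_d -> {charge set (measurableTypeR R) -> \bar R})
             (v : R -> 'rV[R]_d),
        is_derivative_measure a b U DU ->
        is_gderivative g U v ->
        [/\ is_distributional_derivative a b U DU,
            (forall (i : 'I_d) (A : set (measurableTypeR R)),
               measurable A -> A `<=` `[a, b[ ->
               (DU i A = \int[completion (stieltjes_measure g)]_(x in A)
                           (v x ord0 i)%:E)%E) &
            forall (rho : R -> R)
                   (musc : {finite_measure set (measurableTypeR R) -> \bar R}),
              lebesgue_decomposition g rho musc ->
              forall i : 'I_d,
                [/\ completed_lebesgue_measure.-integrable `[a, b[
                      (fun x => (v x ord0 i * rho x)%:E),
                    (completion musc).-integrable `[a, b[
                      (fun x => (v x ord0 i)%:E),
                    summable (jumps g)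
                      (fun t => (jump g t * v t ord0 i)%:E) &
                    forall A : set (measurableTypeR R),
                      measurable A -> A `<=` `[a, b[ ->
                      (DU i A =
                        \int[completed_lebesgue_measure]_(x in A)
                          (v x ord0 i * rho x)%:E
                        + \int[completion musc]_(x in A) (v x ord0 i)%:E
                        + signed_esum (jumps g) (fun t =>
                            (jump g t * v t ord0 i)%:E * \d_t A))%E]]].

Proof.
move=> ab _ UAC.
have gu i : gAC a b g (fun t => U t ord0 i) := UAC i.
split.
- by move=> i; exact: gac_bounded_variation ab (gu i).
- have /choice[w wP] i : exists w : measurableTypeR R -> R,
      (stieltjes_measure g).-integrable [set: measurableTypeR R] (EFin \o w) /\
      forall t, a <= t -> t <= b -> ((U t ord0 i)%:E = (U a ord0 i)%:E +
        \int[stieltjes_measure g]_(x in `[a, t[) (w x)%:E)%E.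
    by have [w iw uw] := gAC_derivative ab (gu i); exists w.
  have mw i : measurable_fun [set: measurableTypeR R] (w i).
    by have [/measurable_int/measurable_EFinP] := wP i.
  (* The densities are already Borel, so the exceptional null set is empty. *)
  have wv i (D : set (measurableTypeR R)) x : D x -> ~ set0 x ->
      w i x = (\row_j w j x) ord0 i by rewrite mxE.
  exists (fun x => \row_i w i x); split=> i.
    have mab : measurable (`[a, b[%classic : set (measurableTypeR R)).
      exact: measurable_itv.
    apply/(completion_integrableE mab measurable0 (measure0 _)
      (measurable_funTS (mw i)) (wv i _)).
    exact: integrableS (wP i).1.
  move=> t at_ tb; rewrite (wP i).2//; congr (_ + _)%E; apply/esym.
  have mat : measurable (`[a, t[%classic : set (measurableTypeR R)).
    exact: measurable_itv.
  exact: (completion_integralE mat measurable0 (measure0 _)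
    (measurable_funTS (mw i)) (wv i _)).
(* The witness is the difference of the Stieltjes measures of the two monotone parts of each
   component. *)
- exists (fun i => cadd
    (charge_of_finite_measure (stieltjes_measure (gac_pos ab (gu i))))
    (copp (charge_of_finite_measure (stieltjes_measure (gac_neg ab (gu i)))))).
  move=> i s t as_ st tb.
  rewrite /= /cadd/= /copp/= !stieltjes_measure_co//= -EFinB.
  by congr (_%:E); ring.
move=> DU v UDU Uv; split.
- move=> i phi tphi.
  by apply: gAC_distributional ab (gu i) _ _ _ tphi => s t *; exact: UDU.
- move=> i A mA Aab.
  have [w [Z [mw _ iw -> // uw]]] := is_gderivative_version i Uv.
  exact: (charge_derivative iw uw (UDU i)).
- move=> rho musc LD i.
  have [w [Z [mw [mZ Z0 wv] iw _ uw]]] := is_gderivative_version i Uv.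
  split.
  + exact: (density_part_integrable LD mw mZ Z0 wv iw).
  + exact: (sc_part_integrable LD mw mZ Z0 wv iw).
  + exact: (jump_part_summable LD mw mZ Z0 wv iw).
  + move=> A mA Aab.
    rewrite (charge_derivative iw uw (UDU i) mA Aab).
    exact: (integral_decomposition LD mw mZ Z0 wv iw mA Aab).
Qed.
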